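(* Let $\mathfrak{g}=\mathfrak{g}_{\bar 0}\oplus\mathfrak{g}_{\bar 1}$ be a classical Lie superalgebra over $\mathbb{C}$ and let $\mathcal{F}$ be the category of finite dimensional $\mathfrak{g}$-supermodules which are finitely semisimple over $\mathfrak{g}_{\bar 0}$. Let $M\in\mathcal{F}$, and let $c_{\mathcal{F}}(M)$ denote the complexity of $M$. Then $c_{\mathcal{F}}(M)=0$ if and only if $M$ is projective in $\mathcal{F}$.
   Context: A finite dimensional Lie superalgebra $\mathfrak{g}=\mathfrak{g}_{\bar 0}\oplus\mathfrak{g}_{\bar 1}$ over $\mathbb{C}$ is called classical if there is a connected reductive algebraic group $G_{\bar 0}$ with $\operatorname{Lie}(G_{\bar 0})=\mathfrak{g}_{\bar 0}$ and an action of $G_{\bar 0}$ on $\mathfrak{g}_{\bar 1}$ which differentiates to the adjoint action of $\mathfrak{g}_{\bar 0}$ on $\mathfrak{g}_{\bar 1}$ (simplicity of $\mathfrak{g}$ is not required). A supermodule is finitely semisimple if it is a direct sum of finite dimensional simple supermodules. $\mathcal{F}$ is the full subcategory of $\mathfrak{g}$-supermodules whose objects are finite dimensional and finitely semisimple over $\mathfrak{g}_{\bar 0}$; it has enough projectives, and every object has a minimal projective resolution. Homological algebra is carried out using the underlying even category (same objects, only even morphisms), which is abelian, together with the parity change functor. For a sequence $V_\bullet=\{V_t\mid t\in\mathbb{N}\}$ of finite dimensional complex vector spaces, the rate of growth $r(V_\bullet)$ is the smallest nonnegative integer $c$ such that there is a constant $C>0$ with $\dim_{\mathbb{C}}V_t\leq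 C\cdot t^{c-1}$ for all $t\geq 1$; if there is no such $c$ the rate of growth is infinite. For $M\in\mathcal{F}$ with minimal projective resolution $P_\bullet\twoheadrightarrow M$ in $\mathcal{F}$, the complexity is $c_{\mathcal{F}}(M)=r(P_\bullet)$. *)

(* Defs.v *)
(* MathComp, with classical logic and real numbers from MathComp-Analysis. *)
From mathcomp Require Import all_boot all_order all_algebra.
From mathcomp Require Import complex mpoly.
From mathcomp Require Import boolp classical_sets reals.

Set Implicit Arguments.
Unset Strict Implicit.
Unset Printing Implicit Defensive.

Import Order.TTheory GRing.Theory Num.Theory.
Local Open Scope classical_set_scope.
Local Open Scope ring_scope.

(* Throughout, the field of complex numbers is R[i] with R : realType. *)

(** * Linear algebraic groups over C, as Zariski closed subgroups of GL_n *)

(* Polynomial functions of the n * n matrix entries. *)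
Definition mx_eval (R : realType) (n : nat) (p : {mpoly R[i][n * n]})
    (A : 'M[R[i]]_n) : R[i] :=
  p.@[fun k => mxvec A 0 k].

(* The derivative of p at the identity matrix in the direction X. *)
Definition mx_diff1 (R : realType) (n : nat) (p : {mpoly R[i][n * n]})
    (X : 'M[R[i]]_n) : R[i] :=
  \sum_k mxvec X 0 k * mx_eval p^`M(k) 1%:M.

(* Zariski closed subsets of GL_n. *)
Definition GL_closed (R : realType) (n : nat) (Z : set 'M[R[i]]_n) : Prop :=
  exists S : set {mpoly R[i][n * n]},
    Z = [set A | A \in unitmx /\ forall p, S p -> mx_eval p A = 0].

Record algebraic_group (R : realType) (n : nat) (G : set 'M[R[i]]_n) : Prop :=
  AlgebraicGroup {
    algebraic_group_closed : GL_closed G;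
    algebraic_group_one : G 1%:M;
    algebraic_group_mul : forall A B, G A -> G B -> G (A *m B);
    algebraic_group_inv : forall A, G A -> G (invmx A) }.

Definition zariski_connected (R : realType) (n : nat) (G : set 'M[R[i]]_n) :
    Prop :=
  forall Y Z : set 'M[R[i]]_n, GL_closed Y -> GL_closed Z ->
    Y `|` Z = G -> Y `&` Z = set0 -> Y = set0 \/ Z = set0.

Definition unipotent_mx (R : realType) (n : nat) (A : 'M[R[i]]_n) : Prop :=
  exists k : nat, iter k (mulmx (A - 1%:M)) 1%:M = 0.

(* The unipotent radical, i.e. the largest closed connected normal unipotent
   subgroup, is trivial. *)
Definition reductive (R : realType) (n : nat) (G : set 'M[R[i]]_n) : Prop :=
  forall U : set 'M[R[i]]_n,
    algebraic_group U -> zariski_connected U -> U `<=` G ->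
    (forall A B, G A -> U B -> U (A *m B *m invmx A)) ->
    (forall A, U A -> unipotent_mx A) ->
    U = [set 1%:M].

(* Lie(G), the tangent space of G at the identity; its bracket is the
   commutator of matrices. *)
Definition Lie (R : realType) (n : nat) (G : set 'M[R[i]]_n) :
    set 'M[R[i]]_n :=
  [set X | forall p, (forall A, G A -> mx_eval p A = 0) -> mx_diff1 p X = 0].

(* The pair (p, k) represents the regular function p / det ^ k on GL_n, and
   every regular function on GL_n is of this form. *)
Definition rfun_eval (R : realType) (n : nat)
    (f : {mpoly R[i][n * n]} * nat) (A : 'M[R[i]]_n) : R[i] :=
  mx_eval f.1 A / (\det A) ^+ f.2.

(* By the product rule, as the derivative of det at the identity is the trace
   and det 1 = 1. *)
Definition rfun_diff1 (R : realType) (n : nat)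
    (f : {mpoly R[i][n * n]} * nat) (X : 'M[R[i]]_n) : R[i] :=
  mx_diff1 f.1 X - f.2%:R * \tr X * mx_eval f.1 1%:M.

(* Rational representation of G on the subspace U of V: each of its matrix
   coefficients A |-> xi (rho A v) is the restriction to G of a regular
   function on GL_n. The values of rho outside G and U are irrelevant. *)
Record rational_rep (R : realType) (n : nat) (G : set 'M[R[i]]_n)
    (V : vectType R[i]) (U : {vspace V}) (rho : 'M[R[i]]_n -> 'End(V)) :
    Prop := RationalRep {
  rational_rep_stable : forall A, G A -> (rho A @: U <= U)%VS;
  rational_rep_one : forall v, v \in U -> rho 1%:M v = v;
  rational_rep_mul : forall A B v, G A -> G B -> v \in U ->
    rho (A *m B) v = rho A (rho B v);
  rational_rep_regular : forall (xi : 'Hom(V, (R[i])^o)) v, v \in U ->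
    exists f, forall A, G A -> xi (rho A v) = rfun_eval f A }.

(* The differential at the identity of rho, acting on U, sends X in Lie(G) to
   D; this does not depend on the representatives f. *)
Definition rep_differential (R : realType) (n : nat) (G : set 'M[R[i]]_n)
    (V : vectType R[i]) (U : {vspace V}) (rho : 'M[R[i]]_n -> 'End(V))
    (X : 'M[R[i]]_n) (D : 'End(V)) : Prop :=
  forall (xi : 'Hom(V, (R[i])^o)) v f, v \in U ->
    (forall A, G A -> xi (rho A v) = rfun_eval f A) ->
    xi (D v) = rfun_diff1 f X.

(** * Classical Lie superalgebras *)

(* Parities are booleans: false is even and true is odd, so that the sum of
   parities is addb and the sign (-1) ^ (i j) is (-1) ^+ (i && j). *)
Record lieSuperalgebra (R : realType) := LieSuperalgebra {
  lsa_sort :> vectType R[i];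
  lsa_part : bool -> {vspace lsa_sort};
  lsa_ad : 'Hom(lsa_sort, 'End(lsa_sort));
  lsa_directv : directv (lsa_part false + lsa_part true);
  lsa_full : (lsa_part false + lsa_part true)%VS = fullv;
  lsa_parity : forall i j x y, x \in lsa_part i -> y \in lsa_part j ->
    lsa_ad x y \in lsa_part (i (+) j);
  lsa_skew : forall i j x y, x \in lsa_part i -> y \in lsa_part j ->
    lsa_ad x y = - ((-1) ^+ (i && j) *: lsa_ad y x);
  lsa_jacobi : forall i j x y z, x \in lsa_part i -> y \in lsa_part j ->
    lsa_ad x (lsa_ad y z) =
      lsa_ad (lsa_ad x y) z + (-1) ^+ (i && j) *: lsa_ad y (lsa_ad x z) }.

(* The isomorphism of Lie algebras between the even part and Lie(G) is given
   by the restriction of psi to the even part. *)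
Definition classical (R : realType) (g : lieSuperalgebra R) : Prop :=
  exists (n : nat) (G : set 'M[R[i]]_n) (psi : 'Hom(g, 'M[R[i]]_n))
         (rho : 'M[R[i]]_n -> 'End(g)),
    [/\ [/\ algebraic_group G, zariski_connected G & reductive G],
        [/\ {in lsa_part g false &, injective psi},
            psi @` [set x | x \in lsa_part g false] = Lie G &
            {in lsa_part g false &, forall x y,
               psi (lsa_ad g x y) = psi x *m psi y - psi y *m psi x}],
        rational_rep G (lsa_part g true) rho &
        forall x, x \in lsa_part g false ->
          rep_differential G (lsa_part g true) rho (psi x) (lsa_ad g x)].

(** * Finite dimensional supermodules and the category F *)

Record smod (R : realType) (g : lieSuperalgebra R) := Smod {
  smod_sort :> vectType R[i];
  smod_part : bool -> {vspace smod_sort};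
  smod_act : 'Hom(g, 'End(smod_sort));
  smod_directv : directv (smod_part false + smod_part true);
  smod_full : (smod_part false + smod_part true)%VS = fullv;
  smod_parity : forall i j x v, x \in lsa_part g i -> v \in smod_part j ->
    smod_act x v \in smod_part (i (+) j);
  smod_bracket : forall i j x y v, x \in lsa_part g i -> y \in lsa_part g j ->
    smod_act (lsa_ad g x y) v =
      smod_act x (smod_act y v)
        - (-1) ^+ (i && j) *: smod_act y (smod_act x v) }.

(* Graded subspaces of M stable under the subspace h of g: the
   subsupermodules of the restriction of M to h when h is a
   subsuperalgebra. *)
Definition subsmod (R : realType) (g : lieSuperalgebra R) (h : {vspace g})
    (M : smod g) (U : {vspace M}) : Prop :=
  U = (U :&: smod_part M false + U :&: smod_part M true)%VS /\
  forall x, x \in h -> (smod_act M x @: U <= U)%VS.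

Definition simple_subsmod (R : realType) (g : lieSuperalgebra R)
    (h : {vspace g}) (M : smod g) (U : {vspace M}) : Prop :=
  [/\ subsmod h U, U <> 0%VS &
      forall W : {vspace M}, subsmod h W -> (W <= U)%VS ->
        W = 0%VS \/ W = U].

Definition finitely_semisimple (R : realType) (g : lieSuperalgebra R)
    (h : {vspace g}) (M : smod g) : Prop :=
  exists (n : nat) (U : 'I_n -> {vspace M}),
    [/\ forall i, simple_subsmod h (U i), directv (\sum_i U i) &
        (\sum_i U i)%VS = fullv].

Definition inF (R : realType) (g : lieSuperalgebra R) (M : smod g) : Prop :=
  finitely_semisimple (lsa_part g false) M.

(* Morphisms of the underlying even category. *)
Definition even_hom (R : realType) (g : lieSuperalgebra R) (M N : smod g)
    (f : 'Hom(M, N)) : Prop :=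
  (forall i, (f @: smod_part M i <= smod_part N i)%VS) /\
  (forall x v, f (smod_act M x v) = smod_act N x (f v)).

Definition projectiveF (R : realType) (g : lieSuperalgebra R) (P : smod g) :
    Prop :=
  inF P /\
  forall (M N : smod g) (f : 'Hom(M, N)) (h : 'Hom(P, N)),
    inF M -> inF N -> even_hom f -> limg f = fullv -> even_hom h ->
    exists2 k : 'Hom(P, M), even_hom k & (f \o k)%VF = h.

(** * Minimal projective resolutions and complexity *)

Definition superfluous (R : realType) (g : lieSuperalgebra R) (M : smod g)
    (K : {vspace M}) : Prop :=
  forall U : {vspace M}, subsmod fullv U -> (U + K)%VS = fullv -> U = fullv.

(* An exact sequence ... -> P 1 -> P 0 -> M -> 0 in which P 0 -> M and each
   P t.+1 -> im (P t.+1 -> P t) are projective covers, i.e. have superfluous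
   kernels. *)
Definition minimal_resolution (R : realType) (g : lieSuperalgebra R)
    (M : smod g) (P : nat -> smod g) : Prop :=
  exists (d : forall t, 'Hom(P t.+1, P t)) (eps : 'Hom(P 0%N, M)),
    [/\ forall t, projectiveF (P t),
        even_hom eps /\ forall t, even_hom (d t),
        [/\ limg eps = fullv, limg (d 0%N) = lker eps &
            forall t, limg (d t.+1) = lker (d t)] &
        superfluous (lker eps) /\ forall t, superfluous (lker (d t))].

(* dim (V t) <= C t ^ (c - 1) for all t >= 1; the exponent is the integer
   c - 1, which is -1 when c = 0. *)
Definition growth_bound (R : realType) (V : nat -> vectType R[i]) (c : nat) :
    Prop :=
  exists2 C : R, 0 < C &
    forall t : nat, (0 < t)%N ->
      (\dim {:V t})%:R <= C * (t%:R : R) ^ (c%:Z - 1).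

Lemma growth_bound_asbool (R : realType) (V : nat -> vectType R[i]) :
  (exists c, growth_bound V c) -> exists c, `[< growth_bound V c >].
Proof. by case=> c hc; exists c; apply/asboolP. Qed.

(* The least c such that growth_bound V c; None stands for infinity. *)
Definition growth_rate (R : realType) (V : nat -> vectType R[i]) : option nat :=
  if pselect (exists c, growth_bound V c) is left h
  then Some (ex_minn (growth_bound_asbool h)) else None.

(* Minimal projective resolutions in F exist and are unique up to isomorphism,
   so that neither the choice made here nor the default None matters. *)
Definition complexity (R : realType) (g : lieSuperalgebra R) (M : smod g) :
    option nat :=
  if pselect (exists P, minimal_resolution M P) is left h
  then growth_rate (fun t => projT1 (cid h) t : vectType R[i]) else None.

(* Main.v *)
(* A finite resolution by projectives splits off its last term as soon as
   projectives are injective, so that complexity 0 forces the minimal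
   resolution to have length 0. Projectives are injective because F is a rigid
   tensor category: a projective P embedded in N gives a surjection
   Hom(N, P (x) P) -> Hom(P, P (x) P), along which p |-> (q |-> p (x) q) lifts,
   and a partial trace of the lift is a retraction of N onto P.

   That F is closed under Hom is Chevalley's theorem: if E is completely
   reducible under a set S of operators, then so is End(E) under ad S. Given an
   ad S-stable U in End(E), let L be the Lie algebra of the operators y such
   that ad y preserves U and y commutes with the commutant of S. With x, it
   contains the operator obtained by conjugating the eigenvalues of the
   semisimple part of x, so that tr(x x') = 0 forces x to be nilpotent; by
   Engel's theorem L has no nonzero ideal of nilpotent operators, and trace
   forms are nondegenerate. Fitting decompositions with respect to Casimir
   operators then produce a Reynolds operator, which turns any projection
   onto U into one that commutes with ad L. *)
Require Import Defs.
From HB Require Import structures.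
From mathcomp Require Import all_boot all_order all_algebra.
From mathcomp Require Import complex reals.
From mathcomp Require Import boolp ring zify.

Set Implicit Arguments.
Unset Strict Implicit.
Unset Printing Implicit Defensive.

Import Order.TTheory GRing.Theory Num.Theory.
Local Open Scope ring_scope.

(** * Jordan decompositions and conjugate eigenvalues *)

(** Complex conjugation has three useful properties: it fixes 0, so that x' is a polynomial in x
    without constant term; it is additive, so that it commutes with [Ad]; and on simultaneous
    eigenvectors tr(x x') becomes a sum of terms |a|^2, which vanishes only termwise. Closure under
    x' treats the centre of L on the same footing as the rest.

    In the splitting, the partial trace feeds basis vectors in as p and pairs the dual basis with
    the factor q, so that on P it is a zigzag identity. Contracting the input equivariantly with the
    factor p would leave the superdimension of P as a coefficient, and that can vanish. Signs are
    the remaining obstacle: an odd element of the superalgebra carries the trace into the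
    supertrace, so the retraction uses the one on even and the other on odd vectors.

    Gradings are handled through the involution s that is 1 on even and -1 on odd vectors: f |-> s f
    s then encodes the sign of f without decomposing f. *)

Lemma hermite_interpolation (F : fieldType) (N : nat) (f : F -> F) (s : seq F) :
  uniq s -> exists q : {poly F},
    forall a, a \in s -> ('X - a%:P) ^+ N %| q - (f a)%:P.
Proof.
elim: s => [|a s IHs] /=; first by exists 0.
case/andP => sa /IHs[q qP].
pose g := \prod_(b <- s) ('X - b%:P) ^+ N.
have gP b : b \in s -> ('X - b%:P) ^+ N %| g.
  by move=> sb; rewrite /g (big_rem b) //= dvdp_mulIl.
have: coprimep (('X - a%:P) ^+ N) g.
  rewrite /g big_seq; elim/big_ind: _ => [|x y cx cy|b sb].
  - exact: coprimep1.
  - by rewrite coprimepMr cx.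
  - apply/coprimep_expl/coprimep_expr; rewrite coprimep_XsubC root_XsubC.
    by apply: contraNneq sa => <-.
case/Bezout_eq1_coprimepP => -[u v] /= uv.
(* The correction is a multiple of [g], which keeps the congruences on [s], and [v * g] is 1 modulo
   the power at [a]. *)
exists (q + g * v * ((f a)%:P - q)) => b; rewrite inE => /predU1P[->|sb].
  have -> : q + g * v * ((f a)%:P - q) - (f a)%:P =
            (u * ('X - a%:P) ^+ N) * (q - (f a)%:P).
    have -> : u * ('X - a%:P) ^+ N = 1 - v * g by rewrite -uv addrK.
    ring.
  by rewrite -mulrA dvdp_mull // dvdp_mulIl.
by rewrite addrAC -mulrA dvdp_add ?qP // dvdp_mulr // gP.
Qed.

Section Diag.
Variables (C : numClosedFieldType) (n : nat).
Implicit Types (A P : 'M[C]_n) (d : 'rV[C]_n).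

Definition nilpotent_mx A := exists k, A ^+ k = 0.

Definition diag_by P d := invmx P *m diag_mx d *m P.

Lemma nilpotent_mxB A B : comm_mx A B -> nilpotent_mx A -> nilpotent_mx B ->
  nilpotent_mx (A - B).
Proof.
move=> cAB [k Ak] [l Bl]; exists (k + l)%N; rewrite exprBn_comm //.
apply: big1 => i _; have [ki|ki] := leqP k (k + l - i).
  by rewrite -(subnK ki) exprD Ak mulr0 mulr0 mul0r mul0rn.
have li : (l <= i)%N by lia.
by rewrite -(subnK li) [B ^+ _]exprD Bl mulr0 mulr0 mul0rn.
Qed.

(** If two diagonalisations agree, the change of basis [R] satisfies R_ij (d_j - d'_i) = 0, and this
    persists after applying [f] to the eigenvalues. So [f] of a diagonalisable matrix is well
    defined. *)
Lemma diag_by_map (f : C -> C) P d Q d' : P \in unitmx -> Q \in unitmx ->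
  diag_by P d = diag_by Q d' ->
  diag_by P (map_mx f d) = diag_by Q (map_mx f d').
Proof.
move=> Pu Qu eD; pose R := Q *m invmx P.
have RD (e e' : 'rV_n) : diag_by P e = diag_by Q e' <->
    R *m diag_mx e = diag_mx e' *m R.
  rewrite /diag_by /R; split=> [E|RE].
    rewrite -[LHS](mulmxK Pu) -!mulmxA (mulmxA (diag_mx e)) (mulmxA (invmx P)).
    by rewrite (mulmxA (invmx P)) E !mulmxA mulmxV // mul1mx.
  rewrite -[LHS](mulKmx Qu) (mulmxA Q) (mulmxA Q) RE.
  by rewrite -!mulmxA mulVmx // mulmx1.
apply/RD/matrixP => i j; move/RD/matrixP: eD => /(_ i j).
rewrite !mul_mx_diag !mul_diag_mx !mxE => /eqP.
rewrite mulrC -subr_eq0 -mulrBl mulf_eq0 subr_eq0.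
by case/orP => /eqP-> ; rewrite ?mulr0 ?mul0r // mulrC.
Qed.

(** The additive Jordan decomposition of [A], with semisimple part [diag_by P d]. *)
Definition jordan P d A :=
  [/\ P \in unitmx, comm_mx A (diag_by P d) & nilpotent_mx (A - diag_by P d)].

Lemma row_diag_by P d i : P \in unitmx ->
  row i P *m diag_by P d = d 0 i *: row i P.
Proof.
by move=> Pu; rewrite -row_mul /diag_by !mulmxA mulmxV // mul1mx row_mul row_diag_mx -scalemxAl -rowE.
Qed.

Lemma eigen_expB A D (v : 'rV_n) (c : C) k : comm_mx A D -> v *m D = c *: v ->
  v *m (A - c%:M) ^+ k = v *m (A - D) ^+ k.
Proof.
move=> cAD; elim: k v => [|k IHk] v vD; first by rewrite !expr0.
rewrite !exprS -!mulmxE !mulmxA.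
have -> : v *m (A - c%:M) = v *m (A - D).
  by rewrite !mulmxBr vD mul_mx_scalar.
apply: IHk; rewrite mulmxBr mulmxBl -mulmxA cAD mulmxA vD.
by rewrite -!scalemxAl vD -scalerBr.
Qed.
End Diag.

Lemma jordan_interpolation (C : numClosedFieldType) n (f : C -> C)
    (P : 'M_n.+1) d A : f 0 = 0 -> jordan P d A ->
  exists2 q : {poly C}, q`_0 = 0 & horner_mx A q = diag_by P (map_mx f d).
Proof.
move=> f0 [Pu cAD [k kP]].
(* The extra node 0, where [f] vanishes, kills the constant term of [q]; the exponent [k.+1] makes
   ['X] divide [q] even when [k] is 0. *)
have [q qP] := hermite_interpolation k.+1 f
   (undup_uniq (0 :: [seq d 0 i | i <- enum 'I_n.+1])).
exists q.
  have /qP : 0 \in undup (0 :: [seq d 0 i | i <- enum 'I_n.+1]).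
    by rewrite mem_undup mem_head.
  rewrite f0 !subr0 exprS => /(dvdp_trans (dvdp_mulr _ (dvdpp _))).
  by rewrite -['X]subr0 -polyC0 dvdp_XsubCl /root horner_coef0 => /eqP.
apply: (can_inj (mulKmx Pu)); apply/row_matrixP => i.
have -> : P *m diag_by P (map_mx f d) = diag_mx (map_mx f d) *m P.
  by rewrite /diag_by !mulmxA mulmxV // mul1mx.
rewrite [RHS]row_mul row_diag_mx -scalemxAl -rowE mxE row_mul.
have /qP/dvdpP[g gE] : d 0 i \in undup (0 :: [seq d 0 i | i <- enum 'I_n.+1]).
  by rewrite mem_undup inE map_f ?orbT // mem_enum.
rewrite -[q](subrK (f (d 0 i))%:P) gE mulrC.
rewrite rmorphD rmorphM rmorphXn rmorphB /= horner_mx_X !horner_mx_C.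
rewrite mulmxDr mul_mx_scalar -mulmxE mulmxA.
rewrite (eigen_expB _ cAD (row_diag_by d i Pu)).
by rewrite exprS kP -mulmxE mulmx0 mulmx0 mul0mx add0r.
Qed.

(** The exponents start at 1: for W inside U, positive powers of [A] map U into W as soon as [A]
    does, which an identity term would spoil. *)
Lemma jordan_transform (C : numClosedFieldType) n (f : C -> C)
    (P : 'M_n) d A : f 0 = 0 -> jordan P d A ->
  exists m (c : 'I_m -> C),
    diag_by P (map_mx f d) = \sum_i c i *: A ^+ i.+1.
Proof.
case: n P d A => [|n] P d A f0 jA.
  by exists 0, (fun=> 0); rewrite [LHS]flatmx0 [RHS]flatmx0.
have [q q0 <-] := jordan_interpolation f0 jA.
exists (size q), (fun i => q`_i.+1).
have qE : q = 'X * \sum_(i < size q) q`_i.+1 *: 'X^i.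
  apply/polyP => -[|i]; rewrite coefXM //= coef_sum.
  have [iq|qi] := ltnP i (size q).
    rewrite (bigD1 (Ordinal iq)) //= coefZ coefXn eqxx mulr1 big1 ?addr0 // => j.
    by rewrite coefZ coefXn eq_sym -val_eqE /= => /negPf->; rewrite mulr0.
  rewrite nth_default ?(leqW qi) // big1 // => j _; rewrite coefZ coefXn.
  by case: eqP => [ij|]; rewrite ?mulr0 //; have := ltn_ord j; rewrite -ij ltnNge qi.
rewrite {1}qE rmorphM rmorph_sum /= horner_mx_X mulr_sumr.
apply: eq_bigr => i _.
by rewrite linearZ /= rmorphXn /= horner_mx_X -scalerAr -exprS.
Qed.

Lemma jordan_exists (C : numClosedFieldType) n (A : 'M[C]_n) :
  exists P d, jordan P d A.
Proof.
case: n A => [|n] A.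
  exists 1%:M, 0; split; first exact: unitmx1.
    by rewrite /comm_mx [LHS]flatmx0 [RHS]flatmx0.
  by exists 0; rewrite [LHS]flatmx0 [RHS]flatmx0.
have [r rE] := closed_field_poly_normal (char_poly A).
rewrite (monicP (char_poly_monic A)) scale1r in rE.
(* The semisimple part is [q] evaluated at [A], where [q] is congruent to each eigenvalue [b] modulo
   a high power of ['X - b%:P]. The radical [h] of the characteristic polynomial annihilates it and
   divides ['X - q], so the difference is nilpotent. *)
have [q qP] := hermite_interpolation (size r).+1 id (undup_uniq r).
pose h : {poly C} := \prod_(b <- undup r) ('X - b%:P).
have horner0 p : h ^+ (size r) %| p -> horner_mx A p = 0.
  suff Ah : char_poly A %| h ^+ size r.
    move=> /(dvdp_trans Ah)/dvdpP[g ->].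
    by rewrite rmorphM /= Cayley_Hamilton mulr0.
  have prod_dvd (s : seq C) : (forall b, b \in s -> 'X - b%:P %| h) ->
      \prod_(b <- s) ('X - b%:P) %| h ^+ size s.
    elim: s => [|b s IHs] sh; first by rewrite big_nil expr0.
    rewrite big_cons exprS dvdp_mul ?sh ?mem_head //.
    by apply: IHs => c cs; apply: sh; rewrite inE cs orbT.
  rewrite rE; apply: prod_dvd => b br.
  by rewrite /h (big_rem b) ?mem_undup //= dvdp_mulIl.
have hroot p : (forall b, b \in undup r -> root p b) -> h %| p.
  by move=> pr; apply: uniq_roots_dvdp; [apply/allP | rewrite uniq_rootsE undup_uniq].
pose D := horner_mx A q.
have rq b : b \in undup r -> root (q - b%:P) b.
  by move=> /qP; rewrite -dvdp_XsubCl; apply: dvdp_trans; rewrite exprS dvdp_mulIl.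
have : diagonalizable D.
  apply/diagonalizableP; exists (undup r); rewrite ?undup_uniq //.
  apply/mxminpoly_minP; rewrite -/h.
  have -> : horner_mx D h = horner_mx A (\prod_(b <- undup r) (q - b%:P)).
    rewrite /h !rmorph_prod; apply: eq_bigr => b _.
    by rewrite !rmorphB /= horner_mx_X !horner_mx_C.
  apply: horner0; rewrite /h -prodrXl !big_seq.
  apply: (big_ind2 (fun x y => x %| y)) => // [x y z t|b /qP].
    exact: dvdp_mul.
  by apply: dvdp_trans; rewrite exprS dvdp_mulIr.
case=> P Pu /diagonalizable_forPex[d] /(simmxLR Pu).
rewrite mxpoly.conjumx ?unitmx_inv // invmxK => DE.
exists P, d; rewrite /jordan /diag_by -DE; split=> //.
  exact: comm_mx_horner.
exists (size r); rewrite /D -[in X in X - _](horner_mx_X A) -rmorphB -rmorphXn; apply/horner0/dvdp_exp2r/hroot => b /rq.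
by rewrite !rootE !hornerE => /eqP qb; rewrite -oppr_eq0 opprB qb.
Qed.

Section JordanTransform.
Variables (C : numClosedFieldType) (n : nat).
Implicit Types (A P : 'M[C]_n) (d : 'rV[C]_n) (f : C -> C).

Lemma jordan_transform_comm f P d A B : f 0 = 0 -> jordan P d A ->
  comm_mx A B -> comm_mx (diag_by P (map_mx f d)) B.
Proof.
move=> f0 /(jordan_transform f0)[m [c ->]] cAB.
rewrite /comm_mx mulmx_suml mulmx_sumr; apply: eq_bigr => i _.
rewrite -scalemxAl -scalemxAr; congr (_ *: _).
by apply/commr_sym/commrX/commr_sym.
Qed.

Lemma jordan_transform_stable f P d A k1 k2 (U : 'M_(k1, n)) (W : 'M_(k2, n)) :
  f 0 = 0 -> jordan P d A -> (W <= U)%MS -> (U *m A <= W)%MS ->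
  (U *m diag_by P (map_mx f d) <= W)%MS.
Proof.
move=> f0 /(jordan_transform f0)[m [c ->]] WU UA.
rewrite mulmx_sumr summx_sub // => i _.
rewrite -scalemxAr scalemx_sub //.
elim: (nat_of_ord i) => [|k IHk]; first by rewrite expr1.
rewrite exprSr -mulmxE mulmxA; apply: submx_trans (submxMr _ IHk) _.
exact: submx_trans (submxMr _ WU) UA.
Qed.

Lemma mxtrace_nilpotent A : nilpotent_mx A -> \tr A = 0.
Proof.
case: n A => [|m] A [k Ak]; first by rewrite [A]flatmx0 mxtrace0.
have [r rE] := closed_field_poly_normal (char_poly A).
rewrite (monicP (char_poly_monic A)) scale1r in rE.
have r0 x : x \in r -> x = 0.
  move=> xr; have : root (char_poly A) x by rewrite rE root_prod_XsubC.
  rewrite -eigenvalue_root_char => /eigenvalueP[v vA v0].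
  apply/eqP; have: v *m A ^+ k = x ^+ k *: v.
    elim: (k) => [|j IHj]; first by rewrite !expr0 mulmx1 scale1r.
    by rewrite exprSr -mulmxE mulmxA IHj -scalemxAl vA scalerA -exprSr.
  rewrite Ak mulmx0 => /eqP; rewrite eq_sym scaler_eq0 (negPf v0) orbF.
  by rewrite expf_eq0 => /andP[].
have cE : char_poly A = 'X^(size r).
  rewrite rE big_seq (eq_bigr (fun=> 'X)) => [|x /r0->]; last by rewrite subr0.
  by rewrite -big_seq big_const_seq count_predT iter_mulr_1.
apply: oppr_inj; rewrite oppr0 -char_poly_trace // cE coefXn.
have := size_char_poly A; rewrite cE size_polyXn => -[->].
by rewrite ltn_eqF /=.
Qed.

(** The nilpotent part of [A] contributes a nilpotent product, of trace 0. In a basis diagonalising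
    the semisimple part and [e] together, the rest of the trace is the sum of |a_i|^2 over the
    eigenvectors fixed by [e]. *)
Lemma trace_mul_conj_eq0 P d A e : jordan P d A -> comm_mx A e ->
  e *m e = e -> \tr (A *m diag_by P (map_mx Num.conj d) *m e) = 0 ->
  diag_by P (map_mx Num.conj d) *m e = 0.
Proof.
move=> jA cAe ee; have [Pu cAD nilN] := jA.
set D := diag_by P d in cAD nilN *; set B := diag_by P (map_mx Num.conj d).
have cBe : comm_mx B e by apply: jordan_transform_comm jA cAe; rewrite conjC0.
have DE : D = diag_by P (map_mx id d) by rewrite map_mx_id.
have cDe : comm_mx D e by rewrite DE; apply: jordan_transform_comm jA cAe.
have cBD : comm_mx B D by apply: jordan_transform_comm jA cAD; rewrite conjC0.
have cBA : comm_mx B A.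
  by apply: jordan_transform_comm jA _; [rewrite conjC0 | exact: erefl].
have -> : \tr (A *m B *m e) = \tr (D *m B *m e).
  rewrite -{1}[A](subrK D) 2!mulmxDl mxtraceD -[RHS]add0r; congr (_ + _).
  apply: mxtrace_nilpotent; case: nilN => k kP; exists k.
  rewrite -mulmxA mulmxE exprMn_comm ?kP ?mul0r //.
  have cNB : GRing.comm (A - D) B.
    by apply/commr_sym/commrB; [exact: cBA | exact: cBD].
  apply: commrM => //; apply/commr_sym/commrB; apply/commr_sym => //.
have [Q Qu] : codiagonalizable [:: D; e].
  apply/codiagonalizableP; split.
    move=> X Y; rewrite !inE => /orP[]/eqP-> /orP[]/eqP-> //; exact: erefl.
  move=> X; rewrite !inE => /orP[]/eqP->.
    exists P => //; apply/diagonalizable_forPex; exists d.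
    by apply/(simmxLR Pu); rewrite mxpoly.conjumx ?unitmx_inv // invmxK.
  case: n e ee {cAe cBe cDe} => [|m] e ee.
    exists 1%:M; rewrite ?unitmx1 //; apply/diagonalizable_forPex.
    by exists 0; apply/(simmxLR (unitmx1 _ _))/matrixP => -[].
  apply/diagonalizableP; exists [:: 0; 1]; first by rewrite /= inE eq_sym oner_eq0.
  apply/mxminpoly_minP; rewrite big_cons big_seq1 subr0 mulrBr rmorphB !rmorphM /=.
  by rewrite horner_mx_X horner_mx_C mulr1 -mulmxE ee subrr.
rewrite /= andbT => /andP[/diagonalizable_forPex[a /(simmxLR Qu)Da]].
case/diagonalizable_forPex=> b /(simmxLR Qu) eb.
rewrite mxpoly.conjumx ?unitmx_inv // invmxK in Da.
rewrite mxpoly.conjumx ?unitmx_inv // invmxK in eb.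
have BE : B = diag_by Q (map_mx Num.conj a) by apply: diag_by_map.
have conjQ X Y : invmx Q *m X *m Q *m (invmx Q *m Y *m Q) = invmx Q *m (X *m Y) *m Q.
  by rewrite !mulmxA mulmxK.
have bb i : b 0 i * b 0 i = b 0 i.
  move: ee; rewrite eb conjQ mulmx_diag => /(canRL (mulmxK Qu)).
  rewrite -[RHS]mulmxA mulmxV // mulmx1 => /(can_inj (mulKVmx Qu)).
  by move/matrixP => /(_ i i); rewrite !mxE eqxx !mulr1n.
rewrite BE eb Da /diag_by !conjQ !mulmx_diag mxtrace_mulC mulKVmx //.
rewrite mxtrace_diag => tr0.
have b_ge0 i : 0 <= b 0 i.
  have /eqP := bb i; rewrite -[X in _ == X]mulr1 -subr_eq0 -mulrBr mulf_eq0.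
  by rewrite subr_eq0 => /orP[]/eqP->.
set c := \row_j _ in tr0.
have /psumr_eq0P c0 i : true -> 0 <= c 0 i.
  by rewrite !mxE mulr_ge0 ?mul_conjC_ge0.
rewrite [X in diag_mx X](_ : _ = 0) ?linear0 ?mulmx0 ?mul0mx //.
apply/rowP => i; move: (c0 tr0 i isT); rewrite !mxE => /eqP.
rewrite -mulrA mulf_eq0 => /orP[/eqP->|/eqP//]; first by rewrite conjC0 mul0r.
Qed.
End JordanTransform.

(** * Engel's theorem *)

Section Subspaces.
Variables (K : fieldType) (V : vectType K).

Lemma exists_max_vspace (Q : {vspace V} -> Prop) (U0 : {vspace V}) : Q U0 ->
  exists2 U, Q U & forall W, Q W -> (\dim W <= \dim U)%N.
Proof.
move=> QU0; pose p k := `[< exists2 U, Q U & \dim U = k >].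
have p0 : exists k, p k by exists (\dim U0); apply/asboolP; exists U0.
have pmax k : p k -> (k <= \dim {:V})%N.
  by case/asboolP => U _ <-; rewrite dimvS ?subvf.
case: (ex_maxnP p0 pmax) => k /asboolP[U QU Uk] kmax.
by exists U => // W QW; rewrite Uk; apply/kmax/asboolP; exists W.
Qed.

(** A subspace of maximal dimension inside [P] contains every vector of [P], as otherwise a line
    could be added to it. *)
Lemma vspace_of_pred (P : V -> Prop) : P 0 ->
  (forall c u v, P u -> P v -> P (c *: u + v)) ->
  exists U : {vspace V}, forall v, v \in U <-> P v.
Proof.
move=> P0 Plin; pose Q (U : {vspace V}) := forall u, u \in U -> P u.
have [|U QU Umax] := @exists_max_vspace Q 0%VS.
  by move=> u; rewrite memv0 => /eqP->.
exists U => v; split=> [/QU//|Pv].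
suff /Umax : Q (U + <[v]>)%VS.
  rewrite (geq_leqif (dimv_leqif_sup (addvSl U <[v]>))) subv_add => /andP[_].
  by rewrite -memvE.
move=> w /memv_addP[u uU [_ /vlineP[c ->] ->]].
by rewrite addrC; apply: Plin => //; apply: QU.
Qed.
End Subspaces.

Section Engel.
Variables (K : fieldType) (n : nat).

Definition mxbr (x y : 'M[K]_n) := x *m y - y *m x.

Definition br_closed (L : {vspace 'M[K]_n}) :=
  forall x y, x \in L -> y \in L -> mxbr x y \in L.

(* Matrices act on the right, as on row vectors. *)
Definition right_action (V : vectType K) (b : 'M[K]_n -> V -> V) :=
  (forall c x y v, b (c *: x + y) v = c *: b x v + b y v) /\
  (forall x y v, b x (b y v) = b y (b x v) + b (mxbr y x) v).

(** The pair of stable subspaces stands for the quotient U'/U: some nonzero vector of it is killed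
    by [H]. The same form serves for L/H under the adjoint action. *)
Definition engel_prop (V : vectType K) (b : 'M[K]_n -> V -> V)
    (H : {vspace 'M[K]_n}) :=
  forall U U' : {vspace V}, (U <= U')%VS -> ~~ (U' <= U)%VS ->
    (forall x u, x \in H -> u \in U -> b x u \in U) ->
    (forall x u, x \in H -> u \in U' -> b x u \in U') ->
    exists u, [/\ u \in U', u \notin U & forall x, x \in H -> b x u \in U].

Definition nilpotent_action (V : vectType K) (b : 'M[K]_n -> V -> V) x :=
  exists k, forall v, iter k (b x) v = 0.

Lemma right_action0 (V : vectType K) (b : 'M[K]_n -> V -> V) v : right_action b -> b 0 v = 0.
Proof.
by case=> lin _; have := lin (-1) 0 0 v; rewrite scaleN1r scaleN1r !addNr.
Qed.

Lemma engel_prop0 (V : vectType K) (b : 'M[K]_n -> V -> V) : right_action b -> engel_prop b 0.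
Proof.
move=> bP U U' _ /subvPn[u uU' uU] _ _; exists u; split=> // x.
by rewrite memv0 => /eqP->; rewrite right_action0 ?mem0v.
Qed.

(** The vectors killed by [H] modulo U are preserved by [x], because [x] normalises [H]. The last
    iterate of [x] on such a vector that is outside U is killed by [x] as well. *)
Lemma engel_prop_step (V : vectType K) (b : 'M[K]_n -> V -> V) H x :
  right_action b -> engel_prop b H ->
  (forall h, h \in H -> mxbr x h \in H) -> nilpotent_action b x ->
  engel_prop b (H + <[x]>)%VS.
Proof.
move=> [lin comm] eH Hx [k kP] U U' UU' nU'U HU HU'.
have HHx : (H <= H + <[x]>)%VS by apply: addvSl.
have xHx : x \in (H + <[x]>)%VS by rewrite memvE addvSr.
have [|h u hH uU|u [uU' uU Hu]] := eH U U' UU' nU'U.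
- by move=> h u hH; apply: HU; apply: (subvP HHx).
- by apply: HU' => //; apply: (subvP HHx).
have W j : iter j (b x) u \in U' /\
    forall h, h \in H -> b h (iter j (b x) u) \in U.
  elim: j => [|j [IH1 IH2]] //=; split; first exact: HU'.
  move=> h hH; rewrite comm memvD ?IH2 ?Hx //.
  by apply: HU => //; apply: IH2.
have ex : exists j, iter j (b x) u \in U by exists k; rewrite kP mem0v.
case: (ex_minnP ex) => -[|j] jU jmin; first by rewrite jU in uU.
have [wU' Hw] := W j; exists (iter j (b x) u); split=> //.
  by apply/negP => /jmin; rewrite ltnn.
move=> _ /memv_addP[h hH [_ /vlineP[c ->] ->]].
by rewrite addrC lin memvD ?Hw // memvZ.
Qed.

Lemma ad_right_action : right_action (fun x y : 'M[K]_n => mxbr y x).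
Proof.
split=> [c x y v|x y v]; rewrite /mxbr.
  rewrite mulmxDr mulmxDl -scalemxAl -scalemxAr opprD scalerBr.
  by rewrite addrACA.
rewrite !(mulmxBl, mulmxBr) !mulmxA !opprB !addrA.
set a := v *m y *m x; set a1 := y *m v *m x; set a2 := x *m v *m y.
set a3 := x *m y *m v; set a4 := y *m x *m v; set a5 := v *m x *m y.
by apply/matrixP => i j; rewrite !mxE; ring.
Qed.

Lemma engel (V : vectType K) (b : 'M[K]_n -> V -> V) (L : {vspace 'M[K]_n}) :
  right_action b -> br_closed L ->
  (forall x, x \in L -> nilpotent_action b x) ->
  (forall x, x \in L -> nilpotent_action (fun x y => mxbr y x) x) ->
  engel_prop b L.
Proof.
move=> bP Lbr nilb nilad.
(* The adjoint case is carried along: applied to [H] inside [L], it supplies an [x] outside [H] that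
   normalises [H], and [H + <[x]>] contradicts maximality. *)
pose Q (H : {vspace 'M[K]_n}) := [/\ (H <= L)%VS, br_closed H, engel_prop b H &
  engel_prop (fun x y : 'M[K]_n => mxbr y x) H].
have [|H [HL Hbr eb ead] Hmax] := @exists_max_vspace _ _ Q 0%VS.
  split; [exact: sub0v| |exact: engel_prop0|exact: engel_prop0 ad_right_action].
  move=> x y; rewrite !memv0 => /eqP-> /eqP->.
  by rewrite /mxbr mulmx0 subr0.
have [LH|LH] := boolP (L <= H)%VS; first by rewrite (@subv_anti _ _ L H) ?LH ?HL.
have [||x [xL xH Hx]] := ead H L HL LH.
- by move=> x u xH uH; apply: Hbr.
- by move=> x u xH uL; apply: Lbr => //; apply: (subvP HL).
have {}Hx h : h \in H -> mxbr x h \in H := Hx h.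
suff /Hmax : Q (H + <[x]>)%VS.
  rewrite (geq_leqif (dimv_leqif_sup (addvSl H <[x]>))) subv_add => /andP[_].
  by rewrite -memvE (negPf xH).
split.
- by rewrite subv_add HL -memvE.
- move=> x1 y1 /memv_addP[h hH [_ /vlineP[c ->] ->]].
  move=> /memv_addP[h' hH' [_ /vlineP[c' ->] ->]].
  have -> : mxbr (h + c *: x) (h' + c' *: x) =
      mxbr h h' + (c *: mxbr x h' - c' *: mxbr x h).
    rewrite /mxbr !(mulmxDl, mulmxDr) -!(scalemxAl, scalemxAr).
    rewrite !scalerBr; apply/matrixP => i j; rewrite !mxE; ring.
  apply: (subvP (addvSl _ _)); apply: memvD; first exact: Hbr.
  by apply: memvB; apply/memvZ/Hx.
- by apply: engel_prop_step => //; apply: nilb.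
- by apply: engel_prop_step; [exact: ad_right_action| | |exact: nilad].
Qed.

End Engel.

(** * The adjoint action on matrices *)

Section MkLfun.
Variables (K : fieldType) (U V : vectType K) (f : U -> V).
Hypothesis f_linear : linear f.

(** The [let] keeps the linearity proof among the arguments, so that the instance below can be
    attached to the constant. *)
Definition mk_lfun_fun : U -> V := let _ := f_linear in f.
HB.instance Definition _ := GRing.isLinear.Build K U V _ mk_lfun_fun f_linear.
Definition mk_lfun : 'Hom(U, V) := locked (linfun mk_lfun_fun).

Lemma mk_lfunE u : mk_lfun u = f u.
Proof. by rewrite /mk_lfun -lock lfunE. Qed.
End MkLfun.

Section Ad.
Variables (C : numClosedFieldType) (n : nat).
Implicit Types (x y P : 'M[C]_n) (d : 'rV[C]_n).

Definition Ad x : 'M[C]_(n * n) := lin_mulmxr x - lin_mulmx x.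

Lemma mul_mxvec_Ad (f x : 'M[C]_n) : mxvec f *m Ad x = mxvec (mxbr f x).
Proof. by rewrite mulmxBr !mul_vec_lin /= -linearB. Qed.

Lemma mxvec_ext p (A B : 'M[C]_(n * n, p)) :
  (forall f : 'M_n, mxvec f *m A = mxvec f *m B) -> A = B.
Proof.
move=> AB; apply/row_matrixP => i; rewrite !rowE.
by rewrite -[delta_mx 0 i]vec_mxK.
Qed.

Lemma Ad_linear : linear Ad.
Proof.
move=> c x y; apply: mxvec_ext => f.
rewrite [RHS]mulmxDr -[in RHS]scalemxAr !mul_mxvec_Ad -linearP /mxbr; congr mxvec.
rewrite mulmxDr mulmxDl -scalemxAr -scalemxAl scalerBr opprD; exact: addrACA.
Qed.

Lemma Ad_mxbr x y : Ad (mxbr x y) = mxbr (Ad x) (Ad y).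
Proof.
apply: mxvec_ext => f.
rewrite mul_mxvec_Ad [mxbr (Ad x) _]/mxbr [RHS]mulmxBr ![in RHS]mulmxA !mul_mxvec_Ad -linearB.
congr mxvec.
have [_ /(_ y x f)] := ad_right_action C n.
by rewrite /mxbr => ->; rewrite addrAC subrr add0r.
Qed.

(** Left and right multiplication by [x] are commuting nilpotents. *)
Lemma Ad_nilpotent x : nilpotent_mx x -> nilpotent_mx (Ad x).
Proof.
move=> [k xk]; apply: nilpotent_mxB.
- apply: mxvec_ext => f; rewrite !mulmxA !mul_vec_lin /= mulmxA //.
- exists k; apply: mxvec_ext => f; rewrite mulmx0.
  rewrite -[RHS](linear0 mxvec) -[0 in RHS](mulmx0 _ f) -xk.
  elim: (k) => [|j IHj]; first by rewrite !expr0 !mulmx1.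
  by rewrite exprSr -mulmxE mulmxA IHj mul_vec_lin /= -mulmxA mulmxE exprSr.
- exists k; apply: mxvec_ext => f; rewrite mulmx0.
  rewrite -[RHS](linear0 mxvec) -[0 in RHS](mul0mx _ f) -xk.
  elim: (k) => [|j IHj]; first by rewrite !expr0 mulmx1 mul1mx.
  by rewrite exprSr -mulmxE mulmxA IHj mul_vec_lin /= mulmxA mulmxE exprS.
Qed.

(** In the matrix units attached to [P], the commutator with a diagonal matrix has the differences
    of its entries as eigenvalues. [Q] is independent of [d], so it also serves for the conjugate
    eigenvalues. *)
Lemma Ad_diag_by P : P \in unitmx -> exists2 Q, Q \in unitmx &
  forall d, Ad (diag_by P d) =
            diag_by Q (mxvec (\matrix_(i, j) (d 0 j - d 0 i))).
Proof.
move=> Pu; pose Q := lin_mulmx (invmx P) *m lin_mulmxr P.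
pose Q' := lin_mulmx P *m lin_mulmxr (invmx P).
have Q'Q : Q' *m Q = 1%:M.
  apply: mxvec_ext => f; rewrite mulmx1 !mulmxA !mul_vec_lin /=.
  by rewrite !mulmxA mulVmx // mul1mx mulmxKV.
have Qu : Q \in unitmx by have [] := mulmx1_unit Q'Q.
exists Q => // d; rewrite /diag_by.
have -> : invmx Q = Q' by rewrite -[LHS]mul1mx -Q'Q mulmxK.
apply: mxvec_ext => f; rewrite mul_mxvec_Ad !mulmxA !mul_vec_lin /=.
have -> g : mxvec g *m diag_mx (mxvec (\matrix_(i, j) (d 0 j - d 0 i))) =
    mxvec (g *m diag_mx d - diag_mx d *m g).
  apply/rowP => k; case/mxvec_indexP: k => i j.
  rewrite !mul_mx_diag mul_diag_mx mxE !mxvecE !mxE.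
  by rewrite mulrBr [X in _ - X]mulrC.
rewrite !mul_vec_lin /=; congr mxvec; rewrite /mxbr !(mulmxBl, mulmxBr) !mulmxA.
by rewrite mulVmx // mul1mx -!mulmxA mulVmx // mulmx1.
Qed.

Lemma jordan_Ad P d x : jordan P d x -> exists (Q : 'M[C]_(n * n)) (e : 'rV[C]_(n * n)), jordan Q e (Ad x) /\
  diag_by Q (map_mx Num.conj e) = Ad (diag_by P (map_mx Num.conj d)).
Proof.
move=> [Pu cxD nilN]; have [Q Qu QE] := Ad_diag_by Pu.
exists Q, (mxvec (\matrix_(i, j) (d 0 j - d 0 i))); split.
  split=> //; rewrite -QE.
    apply/eqP; rewrite -subr_eq0 -/(mxbr _ _) -Ad_mxbr /mxbr cxD subrr.
    by apply/eqP/mxvec_ext => f; rewrite mul_mxvec_Ad /mxbr !(mul0mx, mulmx0) subrr linear0.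
  have -> : Ad x - Ad (diag_by P d) = Ad (x - diag_by P d).
    by rewrite addrC -scaleN1r -Ad_linear scaleN1r addrC.
  exact: Ad_nilpotent.
rewrite QE; congr diag_by; rewrite map_mxvec; congr mxvec.
by apply/matrixP => i j; rewrite !mxE rmorphB.
Qed.

End Ad.

(** * Casimir and Reynolds operators *)

Lemma jordan_conj_eq0 (C : numClosedFieldType) n (P : 'M[C]_n) d x :
  jordan P d x -> diag_by P (map_mx Num.conj d) = 0 -> nilpotent_mx x.
Proof.
move=> [Pu _ nilN] D0; rewrite -[x]subr0.
suff <- : diag_by P d = 0 by [].
have -> : d = 0; last by rewrite /diag_by linear0 mulmx0 mul0mx.
have E : diag_mx (map_mx Num.conj d) = 0.
  have <- : P *m diag_by P (map_mx Num.conj d) *m invmx P = 0.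
    by rewrite D0 mulmx0 mul0mx.
  by rewrite /diag_by !mulmxA mulmxV // mul1mx mulmxK.
apply/rowP => i; move/matrixP: E => /(_ i i).
by rewrite !mxE eqxx mulr1n => /eqP; rewrite conjC_eq0 => /eqP.
Qed.

Section Reynolds.
Variables (C : numClosedFieldType) (n m : nat).
Variables (rho : 'M[C]_n -> 'M[C]_m) (L : {vspace 'M[C]_n}).

Hypothesis rho_linear : linear rho.
Hypothesis rho_mxbr : forall x y, rho (mxbr x y) = mxbr (rho x) (rho y).
Hypothesis rho_jordan : forall P d x, jordan P d x ->
  exists (Q : 'M[C]_m) (e : 'rV[C]_m), jordan Q e (rho x) /\
    diag_by Q (map_mx Num.conj e) = rho (diag_by P (map_mx Num.conj d)).
Hypothesis L_mxbr : br_closed L.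
Hypothesis L_conj : forall P d x, x \in L -> jordan P d x ->
  diag_by P (map_mx Num.conj d) \in L.
Hypothesis L_nil : forall I : {vspace 'M[C]_n}, (I <= L)%VS ->
  (forall x y, x \in I -> y \in L -> mxbr x y \in I) ->
  (forall x, x \in I -> nilpotent_mx x) -> I = 0%VS.

Let rho0 : rho 0 = 0.
Proof. by have := rho_linear (-1) 0 0; rewrite !scaleN1r !addNr. Qed.

Let rhoD x y : rho (x + y) = rho x + rho y.
Proof. by have := rho_linear 1 x y; rewrite !scale1r. Qed.

Let rho_sum k (c : 'I_k -> C) (b : 'I_k -> 'M[C]_n) :
  rho (\sum_i c i *: b i) = \sum_i c i *: rho (b i).
Proof.
elim/big_rec2: _ => [|i x y _ <-]; [exact: rho0 | exact: rho_linear].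
Qed.

(* The non-unital associative algebra generated by rho(L), described through
   its action on pairs of subspaces. *)
Definition augmentation (Z : 'M[C]_m) :=
  forall (Q Q0 : 'rV[C]_m -> Prop), Q0 0 ->
    (forall c u v, Q0 u -> Q0 v -> Q0 (c *: u + v)) ->
    (forall v, Q0 v -> Q v) ->
    (forall x v, x \in L -> Q v -> Q0 (v *m rho x)) ->
    forall v, Q v -> Q0 (v *m Z).

Lemma augmentation_rho x : x \in L -> augmentation (rho x).
Proof. by move=> xL Q Q0 _ _ _ QL v Qv; apply: QL. Qed.

Lemma augmentation0 : augmentation 0.
Proof. by move=> Q Q0 Q00 _ _ _ v _; rewrite mulmx0. Qed.

Lemma augmentation_lin c X Y :
  augmentation X -> augmentation Y -> augmentation (c *: X + Y).
Proof.
move=> aX aY Q Q0 Q00 Qlin QQ QL v Qv; rewrite mulmxDr -scalemxAr.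
by apply: (Qlin c); [apply: (aX Q Q0) | apply: (aY Q Q0)].
Qed.

Lemma augmentationM X Y : augmentation X -> augmentation Y ->
  augmentation (X *m Y).
Proof.
move=> aX aY Q Q0 Q00 Qlin QQ QL v Qv; rewrite mulmxA.
by apply: (aY Q Q0) => //; apply: (QQ _); apply: (aX Q Q0).
Qed.

Lemma augmentation_sum I (r : seq I) (P : pred I) (F : I -> 'M[C]_m) :
  (forall i, P i -> augmentation (F i)) -> augmentation (\sum_(i <- r | P i) F i).
Proof.
move=> aF; elim/big_rec: _ => [|i x Pi ax]; first exact: augmentation0.
by rewrite -[F i]scale1r; apply: augmentation_lin => //; apply: aF.
Qed.

Lemma augmentationZ c X : augmentation X -> augmentation (c *: X).
Proof. by move=> aX; rewrite -[_ *: X]addr0; apply: augmentation_lin => //; apply: augmentation0. Qed.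

Let trace_mxbr p (x y z : 'M[C]_p) :
  \tr (mxbr x z *m y) = \tr (x *m mxbr z y).
Proof.
rewrite /mxbr mulmxBl mulmxBr !mulmxA !linearB /=; congr (_ - _).
by rewrite mxtrace_mulC mulmxA [RHS]mxtrace_mulC mulmxA [RHS]mxtrace_mulC mulmxA.
Qed.

Section Casimir.
Variable e : 'M[C]_m.
Hypothesis e_idem : e *m e = e.
Hypothesis e_comm : forall x, x \in L -> comm_mx (rho x) e.
Hypothesis e_neq0 : exists2 x, x \in L & rho x *m e != 0.

(** The trace form of the representation on the image of [e]. *)
Let form x y := \tr (rho x *m rho y *m e).

Let formC x y : x \in L -> y \in L -> form x y = form y x.
Proof.
move=> xL yL; rewrite /form -mulmxA mxtrace_mulC -!mulmxA -(e_comm xL).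
by rewrite mulmxA.
Qed.

Let form_mxbr x y z : z \in L -> form (mxbr x z) y = form x (mxbr z y).
Proof.
move=> zL; rewrite /form !rho_mxbr -!mulmxA.
have cy : mxbr (rho z) (rho y) *m e = mxbr (rho z) (rho y *m e).
  by rewrite /mxbr mulmxBl -!mulmxA -(e_comm zL).
by rewrite trace_mxbr cy.
Qed.

Let form_suml k (c : 'I_k -> C) b y :
  form (\sum_i c i *: b i) y = \sum_i c i * form (b i) y.
Proof.
rewrite /form rho_sum !mulmx_suml linear_sum; apply: eq_bigr => i _.
by rewrite -!scalemxAl linearZ.
Qed.

Let form_sumr k (c : 'I_k -> C) b x :
  form x (\sum_i c i *: b i) = \sum_i c i * form x (b i).
Proof.
rewrite /form rho_sum mulmx_sumr mulmx_suml linear_sum; apply: eq_bigr => i _.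
by rewrite -scalemxAr -scalemxAl linearZ.
Qed.

(** [J] is the kernel of the action on the image of [e], and [H] its orthogonal in [L] for the trace
    form of the defining representation. Then [L] is the direct sum of [H] and [J], [form] is
    nondegenerate on [H], and the Casimir operator of [H] has trace [\dim H] on the image of [e]. *)
Lemma exists_casimir : exists Om, [/\ forall x, x \in L -> comm_mx (rho x) Om,
  comm_mx Om e, augmentation Om & \tr (Om *m e) != 0].
Proof.
have [|c x y [xL xe] [yL ye]|J JP] :=
    @vspace_of_pred _ _ (fun x => x \in L /\ rho x *m e = 0).
- by rewrite mem0v rho0 mul0mx.
- by rewrite memvD ?memvZ // rho_linear mulmxDl -scalemxAl xe ye scaler0 addr0.
have JL : (J <= L)%VS by apply/subvP => x /JP[].
have J_mxbr x y : x \in L -> y \in J -> mxbr x y \in J.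
  move=> xL /JP[yL ye]; apply/JP; split; first exact: L_mxbr.
  by rewrite rho_mxbr /mxbr mulmxBl -!mulmxA (e_comm xL) ye mulmx0 mulmxA ye
    mul0mx subr0.
have J_conj P d x : jordan P d x -> x \in J -> diag_by P (map_mx Num.conj d) \in J.
  move=> jx /JP[xL xe]; apply/JP; split; first exact: L_conj jx.
  have [Q [d' [jr <-]]] := rho_jordan jx; apply/eqP.
  have/(jordan_transform_comm (conjC0 C) jr) -> := e_comm xL.
  rewrite -submx0; apply: (jordan_transform_stable _ jr); rewrite ?conjC0 ?sub0mx //.
  by rewrite -(e_comm xL) xe.
have lin_phi : linear (fun x : 'M[C]_n => \row_j \tr (x *m (vbasis J)`_j) : 'rV_(\dim J)).
  move=> c x y; apply/rowP => j; rewrite !mxE mulmxDl -scalemxAl.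
  by rewrite linearD linearZ.
pose H := (L :&: lker (mk_lfun lin_phi))%VS.
have HL : (H <= L)%VS by apply: capvSl.
have HP x : x \in H <-> x \in L /\ forall y, y \in J -> \tr (x *m y) = 0.
  rewrite memv_cap memv_ker mk_lfunE; split=> [/andP[xL /eqP/rowP x0]|[xL x0]].
    split=> // y /coord_vbasis->; rewrite mulmx_sumr linear_sum big1 // => i _ /=.
    by have:= x0 i; rewrite -scalemxAr linearZ /= !mxE => ->; rewrite mulr0.
  rewrite xL; apply/eqP/rowP => i; rewrite !mxE x0 //.
  by apply/vbasis_mem/mem_nth; rewrite size_tuple.
have H_mxbr x y : x \in L -> y \in H -> mxbr y x \in H.
  move=> xL /HP[yL yJ]; apply/HP; split=> [|z zJ]; first exact: L_mxbr.
  by rewrite trace_mxbr yJ ?J_mxbr.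
have nilH P d x : jordan P d x -> x \in H -> diag_by P (map_mx Num.conj d) \in J ->
    nilpotent_mx x.
  move=> jx /HP[_ xJ] /xJ t0; apply: (jordan_conj_eq0 jx).
  rewrite -[LHS]mulmx1; apply: (trace_mul_conj_eq0 jx); rewrite ?mulmx1 //.
  by rewrite /comm_mx mulmx1 mul1mx.
(* For x in both, x' lies in [J], so tr(x x') = 0 and x is nilpotent: the intersection is an ideal
   of nilpotents. *)
have HJ0 : (H :&: J = 0)%VS.
  apply: L_nil => [|x y|x].
  - exact: subv_trans (capvSl _ _) HL.
  - move=> /memv_capP[xH xJ] yL; apply/memv_capP; split; first exact: H_mxbr.
    have -> : mxbr x y = - mxbr y x by rewrite /mxbr opprB.
    by rewrite memvN J_mxbr.
  - move=> /memv_capP[xH xJ]; have [P [d jx]] := jordan_exists x.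
    exact: nilH jx xH (J_conj _ _ _ jx xJ).
(* Dimension count: [H] is the kernel on [L] of a map into a space of dimension [\dim J]. *)
have LHJ : (L <= H + J)%VS.
  have HJL : (H + J <= L)%VS by rewrite subv_add HL.
  rewrite -(geq_leqif (dimv_leqif_sup HJL)) dimv_disjoint_sum //.
  rewrite -(limg_ker_dim (mk_lfun lin_phi) L) leq_add2l.
  by apply: leq_trans (dimvS (subvf _)) _; rewrite dimvf dim_matrix mul1r.
(* The radical is an ideal. For u in it, u' lies in [L], so that form u u' = 0 puts u' in [J]; as
   [H] is orthogonal to [J], tr(u u') = 0 and u is nilpotent. *)
have form_eq0 x : x \in H -> (forall y, y \in H -> form x y = 0) -> x = 0.
  move=> xH x0; have [||I IP] :=
      @vspace_of_pred _ _ (fun x => x \in H /\ forall y, y \in L -> form x y = 0).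
  - by rewrite mem0v; split=> // y _; rewrite /form rho0 !mul0mx mxtrace0.
  - move=> c u v [uH u0] [vH v0]; rewrite memvD ?memvZ //; split=> // y yL.
    rewrite /form rho_linear !mulmxDl -!scalemxAl linearD linearZ /= -!/(form _ _).
    by rewrite u0 // v0 // mulr0 addr0.
  have I0 : I = 0%VS.
    apply: L_nil.
    - by apply: subv_trans HL; apply/subvP => u /IP[].
    - move=> u v /IP[uH u0] vL; apply/IP; split; first exact: H_mxbr.
      by move=> y yL; rewrite form_mxbr // u0 // L_mxbr.
    - move=> u /IP[uH u0]; have [P [d ju]] := jordan_exists u.
      have uL := subvP HL _ uH.
      apply: (nilH _ _ _ ju) => //; apply/JP.
      have bL := L_conj uL ju; split=> //.
      have [Q [d' [jr E]]] := rho_jordan ju.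
      rewrite -E; apply: (trace_mul_conj_eq0 jr) => //; first exact: e_comm.
      by rewrite E; apply: u0.
  apply/eqP; rewrite -memv0 -I0; apply/IP; split=> // y /(subvP LHJ).
  case/memv_addP=> h hH [j /JP[jL je] ->].
  rewrite /form rhoD mulmxDr mulmxDl linearD /= -/(form x h) x0 // add0r.
  by rewrite -mulmxA je mulmx0 mxtrace0.
pose k := \dim H; pose b (i : 'I_k) := (vbasis H)`_i.
have bH i : b i \in H by apply/vbasis_mem/mem_nth; rewrite size_tuple.
have bL i : b i \in L by apply: (subvP HL).
pose G := \matrix_(i, j) form (b i) (b j).
have GT : G^T = G by apply/matrixP => i j; rewrite !mxE formC.
have Gu : G \in unitmx.
  rewrite -row_free_unit; apply/inj_row_free => v vG.
  have : \sum_i v 0 i *: b i = 0.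
    apply: form_eq0 => [|y yH]; first by apply: memv_suml => i _; apply/memvZ/bH.
    rewrite (coord_vbasis yH) form_sumr big1 // => j _.
    rewrite form_suml; move/rowP/(_ j): vG; rewrite !mxE => vG.
    by rewrite (eq_bigr (fun i => v 0 i * G i j)) ?vG ?mulr0 // => i _; rewrite mxE.
  move=> v0; apply/rowP => i; rewrite mxE.
  by have /freeP -> := basis_free (vbasisP H).
pose T (g : 'M_k) := \sum_i \sum_j g i j *: (rho (b i) *m rho (b j)).
have Tbr x (c : 'M_k) g : (forall i, mxbr (b i) x = \sum_j c i j *: b j) ->
    mxbr (T g) (rho x) = T (c^T *m g + g *m c).
  move=> cP; have rc i : mxbr (rho (b i)) (rho x) = \sum_k c i k *: rho (b k).
    by rewrite -rho_mxbr cP rho_sum.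
  transitivity (\sum_i \sum_j (\sum_k (g i j * c i k) *: (rho (b k) *m rho (b j)) +
                  \sum_k (g i j * c j k) *: (rho (b i) *m rho (b k)))).
    rewrite /mxbr /T mulmx_suml mulmx_sumr -sumrB; apply: eq_bigr => i _.
    rewrite mulmx_suml mulmx_sumr -sumrB; apply: eq_bigr => j _.
    rewrite -scalemxAl -scalemxAr -scalerBr.
    have -> : rho (b i) *m rho (b j) *m rho x - rho x *m (rho (b i) *m rho (b j)) =
       mxbr (rho (b i)) (rho x) *m rho (b j) + rho (b i) *m mxbr (rho (b j)) (rho x).
      by rewrite /mxbr mulmxBl mulmxBr !mulmxA [RHS]addrC addrA subrK.
    rewrite !rc mulmx_suml mulmx_sumr scalerDr !scaler_sumr.
    by congr (_ + _); apply: eq_bigr => k0 _; rewrite -?scalemxAl -?scalemxAr scalerA.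
  transitivity (\sum_i \sum_j (\sum_k0 (c k0 i * g k0 j) *: (rho (b i) *m rho (b j)) +
                  \sum_k0 (g i k0 * c k0 j) *: (rho (b i) *m rho (b j)))).
    under eq_bigr do rewrite big_split /=.
    under [RHS]eq_bigr do rewrite big_split /=.
    rewrite !big_split /=; congr (_ + _).
      rewrite exchange_big /= [RHS]exchange_big /=; apply: eq_bigr => j _.
      rewrite exchange_big /=; apply: eq_bigr => i _; apply: eq_bigr => k0 _.
      by rewrite mulrC.
    by apply: eq_bigr => i _; rewrite exchange_big.
  apply: eq_bigr => i _; apply: eq_bigr => j _.
  rewrite -!scaler_suml -scalerDl; congr (_ *: _); rewrite !mxE.
  by congr (_ + _); apply: eq_bigr => k0 _; rewrite ?mxE.
exists (T (invmx G)); split.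
- move=> x xL; pose c := \matrix_(i, j) coord (vbasis H) j (mxbr (b i) x).
  have cP i : mxbr (b i) x = \sum_j c i j *: b j.
    rewrite {1}(coord_vbasis (H_mxbr _ _ xL (bH i))).
    by apply: eq_bigr => j _; rewrite mxE.
  (* Infinitesimal invariance of the form. Multiplied by [invmx G] on both sides, it says that the
     action of [x] on coefficient matrices kills [invmx G]. *)
  have cG : c *m G + G *m c^T = 0.
    apply/matrixP => i j; rewrite !mxE.
    rewrite (eq_bigr (fun k0 => c i k0 * form (b k0) (b j))); last first.
      by move=> k0 _; rewrite [G _ _]mxE.
    rewrite [X in _ + X](eq_bigr (fun k0 => c j k0 * form (b i) (b k0))); last first.
      by move=> k0 _; rewrite [G _ _]mxE [c^T _ _]mxE mulrC.
    rewrite -form_suml -form_sumr -!cP form_mxbr // /form -linearD /=.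
    rewrite -mulmxDl -mulmxDr -rhoD.
    have -> : mxbr x (b j) + mxbr (b j) x = 0 by rewrite /mxbr addrA subrK subrr.
    by rewrite rho0 mulmx0 mul0mx mxtrace0.
  apply/esym/eqP; rewrite -subr_eq0 -/(mxbr _ _) (Tbr _ c) //.
  have -> : c^T *m invmx G + invmx G *m c = 0.
    have := congr1 (fun X => invmx G *m X *m invmx G) cG.
    rewrite mulmx0 mul0mx mulmxDr mulmxDl !mulmxA mulVmx // mul1mx.
    by rewrite mulmxK // addrC.
  rewrite /T big1 // => i _; rewrite big1 // => j _; rewrite mxE scale0r //.
- rewrite /comm_mx /T mulmx_suml mulmx_sumr; apply: eq_bigr => i _.
  rewrite mulmx_suml mulmx_sumr; apply: eq_bigr => j _.
  rewrite -scalemxAl -scalemxAr -mulmxA (e_comm (bL j)) mulmxA (e_comm (bL i)).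
  by rewrite -mulmxA.
- apply: augmentation_sum => i _; apply: augmentation_sum => j _.
  apply: augmentationZ; apply: augmentationM; exact: augmentation_rho.
- have -> : \tr (T (invmx G) *m e) = \tr (invmx G *m G).
    rewrite /T mulmx_suml linear_sum; apply: eq_bigr => i _.
    rewrite mulmx_suml linear_sum [RHS]mxE; apply: eq_bigr => j _.
    by rewrite -scalemxAl linearZ /= [G j i]mxE formC.
  (* If [\dim H] were 0, [L] would equal [J] and act by zero on the image of [e]. *)
  rewrite mulVmx // mxtrace1 pnatr_eq0 dimv_eq0; apply/negP => /eqP H0.
  have [x xL /negP[]] := e_neq0; have := subvP LHJ x xL.
  by rewrite H0 add0v => /JP[_ ->].
Qed.
End Casimir.
End Reynolds.

Lemma augmentation_horner (C : numClosedFieldType) n m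
    (rho : 'M[C]_n -> 'M_m.+1) L (Om : 'M_m.+1) q :
  augmentation rho L Om -> augmentation rho L (Om *m horner_mx Om q).
Proof.
move=> aOm; elim/poly_ind: q => [|q c IHq].
  by rewrite rmorph0 mulmx0; apply: augmentation0.
rewrite rmorphD rmorphM /= horner_mx_X horner_mx_C mulmxDr -mulmxE mulmxA.
rewrite mul_mx_scalar addrC; apply: augmentation_lin => //.
exact: augmentationM.
Qed.

(** [p] projects onto the generalised kernel of [Om]. Its complement is written as a multiple of
    [Om], so that it lies in the augmentation whenever [Om] does. *)
Lemma fitting (C : numClosedFieldType) m (Om : 'M[C]_m.+1) :
  exists (k : nat) (q : {poly C}), let p := 1%:M - Om *m horner_mx Om q in
    p *m p = p /\ Om ^+ k.+1 *m p = 0.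
Proof.
(* The extra factor ['X] makes 0 a root, so that [k] is positive and the Bezout term [v * 'X^k] has
   a factor ['X] to spare. *)
have f0 : 'X * char_poly Om != 0.
  by rewrite mulf_neq0 ?polyX_eq0 // monic_neq0 ?char_poly_monic.
have [k [r]] := multiplicity_XsubC ('X * char_poly Om) 0.
rewrite f0 /= subr0 => r0 fE.
have k_gt0 : (0 < k)%N.
  case: k fE => // fE; move: r0; rewrite -[r]mulr1 -fE rootE.
  by rewrite hornerM hornerX mul0r eqxx.
have: coprimep r ('X ^+ k).
  by apply: coprimep_expr; rewrite -['X]subr0 -polyC0 coprimep_XsubC.
case/Bezout_eq1_coprimepP=> -[u v] /= uv.
exists k.-1, (v * 'X^(k.-1)) => /=; set p := 1%:M - _.
have pE : p = horner_mx Om (u * r).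
  have -> : u * r = 1 - 'X * (v * 'X^(k.-1)).
    by rewrite -uv mulrCA -exprS prednK // addrK.
  by rewrite rmorphB rmorph1 rmorphM /= horner_mx_X.
have Okp : Om ^+ k.-1.+1 *m p = 0.
  rewrite prednK // pE -[X in X ^+ k](horner_mx_X Om) -rmorphXn /= mulmxE -rmorphM.
  have -> : 'X^k * (u * r) = u * 'X * char_poly Om by rewrite -mulrA fE; ring.
  by rewrite rmorphM /= Cayley_Hamilton mulr0.
split=> //; rewrite {2}/p mulmxBr mulmx1.
suff -> : p *m (Om *m horner_mx Om (v * 'X^(k.-1))) = 0 by rewrite subr0.
have -> : p *m (Om *m horner_mx Om (v * 'X^(k.-1))) =
    horner_mx Om v *m (Om ^+ k.-1.+1 *m p).
  transitivity (horner_mx Om (v * ('X^(k.-1.+1) * (u * r)))); last first.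
    by rewrite rmorphM /= [horner_mx Om ('X^_ * _)]rmorphM /= rmorphXn /= horner_mx_X -pE -!mulmxE.
  have -> : v * ('X^(k.-1.+1) * (u * r)) = u * r * ('X * (v * 'X^(k.-1))).
    by rewrite exprS; ring.
  by rewrite [RHS]rmorphM /= -pE [horner_mx Om ('X * _)]rmorphM /= horner_mx_X -!mulmxE.
by rewrite Okp mulmx0.
Qed.

(** Among the invariant idempotents whose complement lies in the augmentation, [e] has least rank.
    If [L] acted nontrivially on its image, a Casimir operator would have nonzero trace there. But
    cutting [e] down by the Fitting projection [p] gives a competitor, so minimality makes the
    Casimir operator nilpotent on the image of [e]. *)
Theorem reynolds (C : numClosedFieldType) n m (rho : 'M[C]_n -> 'M[C]_m)
    (L : {vspace 'M[C]_n}) :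
  linear rho ->
  (forall x y, rho (mxbr x y) = mxbr (rho x) (rho y)) ->
  (forall P d x, jordan P d x ->
    exists (Q : 'M[C]_m) (e : 'rV[C]_m), jordan Q e (rho x) /\
      diag_by Q (map_mx Num.conj e) = rho (diag_by P (map_mx Num.conj d))) ->
  br_closed L ->
  (forall P d x, x \in L -> jordan P d x ->
    diag_by P (map_mx Num.conj d) \in L) ->
  (forall I : {vspace 'M[C]_n}, (I <= L)%VS ->
    (forall x y, x \in I -> y \in L -> mxbr x y \in I) ->
    (forall x, x \in I -> nilpotent_mx x) -> I = 0%VS) ->
  exists e, augmentation rho L (1%:M - e) /\
    forall x, x \in L -> e *m rho x = 0.
Proof.
move=> rho_lin rho_br rho_jordan L_br L_conj L_nil.
pose R e := [/\ e *m e = e, forall x, x \in L -> comm_mx (rho x) e &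
  augmentation rho L (1%:M - e)].
pose rk k := `[< exists2 e, R e & \rank e = k >].
have /ex_minnP[k /asboolP[e [ee ce ae] ek] kmin] : exists k, rk k.
  exists (\rank (1%:M : 'M[C]_m)); apply/asboolP; exists 1%:M => //.
  split=> [|x _|]; rewrite ?mulmx1 ?subrr //; last exact: augmentation0.
  by rewrite /comm_mx mulmx1 mul1mx.
exists e; split=> // x xL; apply/eqP; rewrite -(ce _ xL); apply/negPn/negP => xe.
have [|Om [cO Oe aO]] :=
  exists_casimir rho_lin rho_br rho_jordan L_br L_conj L_nil ee ce.
  by exists x.
move/eqP; case; apply: mxtrace_nilpotent.
case: m rho e Om rho_lin rho_br rho_jordan @R @rk k ee ce ae ek kmin xe cO Oe aO
  => [|m'] rho' e Om rho_lin rho_br rho_jordan R rk k ee ce ae ek kmin xe cO Oe aO.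
  by exists 0; rewrite [LHS]flatmx0 [RHS]flatmx0.
have [l [q /= [pp Op]]] := fitting Om.
move: pp Op; set z := Om *m _; set p := 1%:M - z => pp Op.
have commp y : comm_mx y Om -> comm_mx y p.
  move=> yO; have yz : comm_mx y z.
    by apply: comm_mxM => //; apply: comm_mx_horner.
  by apply: comm_mxB => //; rewrite /comm_mx mulmx1 mul1mx.
have ep : e *m p = p *m e by apply/commp/esym.
have /kmin : rk (\rank (e *m p)).
  apply/asboolP; exists (e *m p) => //; split=> [|y yL|].
  - by rewrite -mulmxA (mulmxA p) -ep -mulmxA pp mulmxA ee.
  - by apply: comm_mxM; [exact: ce | apply/commp/cO].
  - have -> : 1%:M - e *m p = (-1) *: ((1%:M - e) *m z) + ((1%:M - e) + z).
      rewrite /p mulmxBr mulmx1 mulmxBl mul1mx scaleN1r opprB opprB.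
      by apply/matrixP=> i j; rewrite !mxE; ring.
    have az : augmentation rho' L z by apply: augmentation_horner.
    apply: augmentation_lin; first exact: augmentationM.
    by rewrite -[1%:M - e]scale1r; apply: augmentation_lin.
rewrite -ek => rank_ep.
have le_ep : (e *m p <= e)%MS by rewrite ep submxMl.
have /andP[_ /submxP[X eX]] : (e *m p == e)%MS.
  by rewrite -(geq_leqif (mxrank_leqif_eq le_ep)).
have eE : e = p *m e by rewrite -ep [in RHS]eX -mulmxA -[_ *m p *m p]mulmxA pp.
exists l.+1; rewrite exprMn_comm; last exact: Oe.
by rewrite [e ^+ _]exprS [in X in _ * (X * _)]eE -!mulmxE !mulmxA Op !mul0mx.
Qed.

(** * Chevalley's theorem *)

Lemma mx_of_pred (K : fieldType) n (P : 'rV[K]_n -> Prop) : P 0 ->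
  (forall c u v, P u -> P v -> P (c *: u + v)) ->
  exists M : 'M_n, forall v, (v <= M)%MS <-> P v.
Proof.
move=> P0 Plin; have [W WP] := vspace_of_pred P0 Plin.
exists <<\matrix_(i < \dim W) (vbasis W)`_i>>%MS => v.
rewrite genmxE; split=> [/submxP[D ->]|/WP vW].
  apply/WP; rewrite mulmx_sum_row memv_suml // => i _; rewrite rowK.
  by apply/memvZ/vbasis_mem/mem_nth; rewrite size_tuple.
rewrite (coord_vbasis vW) summx_sub // => i _; apply: scalemx_sub.
by rewrite -(rowK (fun i : 'I__ => (vbasis W)`_i)) row_sub.
Qed.

Definition completely_reducible_mx (K : fieldType) n (S : 'M[K]_n -> Prop) :=
  forall U : 'M_n, (forall s, S s -> (U *m s <= U)%MS) ->
  exists e, [/\ forall s, S s -> comm_mx s e, (e <= U)%MS & U *m e = U].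

(** The common kernel [M] of [I] is stable under [S] because [I] is an ideal. A projection [e] onto
    [M] commuting with [S] commutes with [L], so its kernel [W] is stable under [I]. If [W] were
    nonzero, Engel's theorem would give a nonzero vector of [W] killed by [I], hence in [M]. *)
Lemma nilpotent_ideal_eq0 (C : numClosedFieldType) n (S : 'M[C]_n -> Prop)
    (L I : {vspace 'M[C]_n}) :
  completely_reducible_mx S -> (forall s, S s -> s \in L) ->
  (forall y z, y \in L -> (forall s, S s -> comm_mx s z) -> comm_mx y z) ->
  (I <= L)%VS -> (forall x y, x \in I -> y \in L -> mxbr x y \in I) ->
  (forall x, x \in I -> nilpotent_mx x) -> I = 0%VS.
Proof.
move=> Scr SL Lcomm IL I_br I_nil.
have [|c u v u0 v0 x xI|M MP] := @mx_of_pred _ _ (fun v => forall x, x \in I -> v *m x = 0).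
- by move=> x _; rewrite mul0mx.
- by rewrite mulmxDl -scalemxAl u0 // v0 // scaler0 addr0.
have [s sS|e [eS eM Me]] := Scr M.
  apply/row_subP => i; apply/MP => x xI; rewrite row_mul.
  have /MP Mi := row_sub i M.
  have := Mi _ (I_br _ _ xI (SL _ sS)).
  by rewrite /mxbr mulmxBr !mulmxA Mi // mul0mx sub0r => /eqP; rewrite oppr_eq0 => /eqP.
have ee : e *m e = e by have /submxP[D eE] := eM; rewrite {1}eE -mulmxA Me -eE.
have [|c u v /= u0 v0|W WP] := @vspace_of_pred _ _ (fun v : 'rV_n => v *m e = 0).
- exact: mul0mx.
- by rewrite mulmxDl -scalemxAl u0 v0 scaler0 addr0.
have [W0|nW] := boolP (W <= 0)%VS.
  apply/eqP; rewrite -subv0; apply/subvP => x xI; rewrite memv0.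
  apply/eqP/row_matrixP => i; rewrite row0 rowE; move: x xI; apply/MP.
  set v := delta_mx _ _; have : v - v *m e \in W.
    by apply/WP; rewrite mulmxBl -mulmxA ee subrr.
  move/(subvP W0); rewrite memv0 subr_eq0 => /eqP->.
  by apply: submx_trans eM; apply: submxMl.
have act : right_action (fun (x : 'M_n) (v : 'rV[C]_n) => v *m x).
  split=> [c x y v|x y v]; first by rewrite mulmxDr -scalemxAr.
  by rewrite /mxbr mulmxBr !mulmxA addrC subrK.
have [|||||||u [/WP ue]] := @engel _ _ _ _ I act _ _ _ 0%VS W.
- by move=> x y xI yI; apply: I_br => //; apply: (subvP IL).
- move=> x /I_nil[k xk]; exists k => v.
  rewrite -[RHS](mulmx0 _ v) -xk; elim: (k) => [|j IHj] /=; first by rewrite mulmx1.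
  by rewrite IHj exprSr -mulmxE mulmxA.
- move=> x /I_nil/Ad_nilpotent[k xk]; exists k => y; apply: (can_inj mxvecK).
  rewrite linear0 -[RHS](mulmx0 _ (mxvec y)) -xk.
  elim: (k) => [|j IHj] /=; first by rewrite mulmx1.
  by rewrite -mul_mxvec_Ad IHj exprSr -mulmxE mulmxA.
- exact: sub0v.
- exact: nW.
- by move=> x u xI; rewrite !memv0 => /eqP->; rewrite mul0mx.
- move=> x u xI /WP ue; apply/WP.
  have xe : comm_mx x e by apply: Lcomm => //; apply: (subvP IL).
  by rewrite -mulmxA xe mulmxA ue mul0mx.
rewrite memv0 => u0 uI; case/negP: u0.
have /submxP[D uE] : (u <= M)%MS.
  by apply/MP => x /uI; rewrite memv0 => /eqP.
by rewrite -ue uE -mulmxA Me.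
Qed.

(* Chevalley: in characteristic 0, the tensor square of a semisimple
   representation is semisimple. *)
Theorem completely_reducible_Ad (C : numClosedFieldType) n (S : 'M[C]_n -> Prop) :
  completely_reducible_mx S ->
  completely_reducible_mx (fun y => exists2 s, S s & y = Ad s).
Proof.
move=> Scr U US.
have {}US s : S s -> (U *m Ad s <= U)%MS by move=> sS; apply: US; exists s.
(* The commutant condition makes every projection commuting with [S] commute with [L]. Both
   conditions survive conjugation, since x' and Ad x' are polynomials without constant term in x and
   Ad x. *)
have [|c x y [xU xc] [yU yc]|L LP] := @vspace_of_pred _ _ (fun y : 'M[C]_n =>
    (U *m Ad y <= U)%MS /\ forall z, (forall s, S s -> comm_mx s z) -> comm_mx y z).
- split=> [|z _]; last by rewrite /comm_mx mul0mx mulmx0.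
  have -> : Ad 0 = 0 :> 'M[C]_(n * n).
    by have := Ad_linear (-1) (0 : 'M[C]_n) 0; rewrite !scaleN1r !addNr.
  by rewrite mulmx0 sub0mx.
- split=> [|z zS].
    by rewrite Ad_linear mulmxDr -scalemxAr addmx_sub // scalemx_sub.
  by rewrite /comm_mx mulmxDl mulmxDr -scalemxAl -scalemxAr xc // yc.
have SL s : S s -> s \in L by move=> sS; apply/LP; split; [exact: US | move=> z; apply].
(* The representation is on the endomorphisms of the matrix space, where the projections onto [U]
   live. *)
have [||||||e0 [ae0 e0L]] := @reynolds C n _ (fun x => Ad (Ad x)) L.
- by move=> c x y; rewrite !Ad_linear.
- by move=> x y; rewrite !Ad_mxbr.
- move=> P d x /jordan_Ad[Q [d' [jQ <-]]].
  by have [Q' [d'' [jQ' <-]]] := jordan_Ad jQ; exists Q', d''.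
- move=> x y /LP[xU xc] /LP[yU yc]; apply/LP; split=> [|z zS].
    rewrite Ad_mxbr /mxbr mulmxBr !mulmxA addmx_sub // ?eqmx_opp.
      by apply: submx_trans (submxMr _ xU) yU.
    by apply: submx_trans (submxMr _ yU) xU.
  have [xz yz] := (xc z zS, yc z zS).
  by rewrite /comm_mx /mxbr mulmxBl mulmxBr -!mulmxA xz yz !mulmxA xz yz.
- move=> P d x /LP[xU xc] jx; apply/LP; split=> [|z zS].
    have [Q [d' [jQ <-]]] := jordan_Ad jx.
    by apply: (jordan_transform_stable _ jQ); rewrite ?conjC0.
  by apply: (jordan_transform_comm _ jx); rewrite ?conjC0 //; apply: xc.
- by move=> I; apply: (nilpotent_ideal_eq0 Scr SL) => y z /LP[_ yc] zS; apply: yc.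
(* [f] is an arbitrary projection onto [U] and [g] its Reynolds average. Bracketing with [L] sends
   maps into [U] that are scalar on [U] to maps into [U] that vanish on [U]; hence so does the
   augmentation, and [g] is still a projection onto [U]. *)
pose f := pinvmx U *m U.
have Uf : U *m f = U by rewrite mulmxA mulmxKpV.
pose g := vec_mx (mxvec f *m e0).
have [fgU Ufg] : (f - g <= U)%MS /\ U *m (f - g) = 0.
  have -> : f - g = vec_mx (mxvec f *m (1%:M - e0)).
    by rewrite mulmxBr mulmx1 linearB /= mxvecK.
  apply: (ae0 (fun v => (vec_mx v <= U)%MS /\ exists c, U *m vec_mx v = c *: U)
    (fun v => (vec_mx v <= U)%MS /\ U *m vec_mx v = 0)).
  - by rewrite linear0 mulmx0 sub0mx.
  - move=> c u v [uU u0] [vU v0]; rewrite linearP /= addmx_sub ?scalemx_sub //.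
    by rewrite mulmxDr -scalemxAr u0 v0 scaler0 addr0.
  - by move=> v [vU v0]; split=> //; exists 0; rewrite scale0r.
  - move=> x v /LP[xU _] [vU [c vc]].
    rewrite -[v]vec_mxK mul_mxvec_Ad mxvecK /mxbr; move: vU vc.
    set w := vec_mx v => wU wc; split.
      apply: addmx_sub; first exact: submx_trans (submxMr _ wU) xU.
      by rewrite eqmx_opp mulmx_sub.
    rewrite mulmxBr !mulmxA wc; have /submxP[D xD] := xU.
    by rewrite xD -mulmxA wc -scalemxAl xD -scalemxAr subrr.
  - by rewrite mxvecK; split; [exact: submxMl | exists 1; rewrite scale1r].
have fU : (f <= U)%MS by apply: submxMl.
exists g; split.
- move=> _ [s sS ->].
  have := congr1 (mulmx (mxvec f)) (e0L s (SL s sS)).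
  rewrite mulmx0 mulmxA -[mxvec f *m e0]vec_mxK mul_mxvec_Ad.
  by move/(congr1 vec_mx); rewrite mxvecK linear0 /mxbr => /eqP; rewrite subr_eq0 => /eqP.
- by rewrite -[g](subKr f) addmx_sub // eqmx_opp.
- by move/eqP: Ufg; rewrite mulmxBr Uf subr_eq0 => /eqP.
Qed.

(** * Complete reducibility for families of operators *)

Section Families.
Variables (K : fieldType) (V : vectType K) (I : Type) (a : I -> 'End(V)).

Definition stablev (U : {vspace V}) := forall i u, u \in U -> a i u \in U.

Definition simplev (U : {vspace V}) :=
  [/\ stablev U, U <> 0%VS &
      forall W, stablev W -> (W <= U)%VS -> W = 0%VS \/ W = U].

(** The simple stable subspaces span the whole space, phrased without forming their sum. *)
Definition simple_generated :=
  forall X, stablev X -> X <> fullv -> exists2 S, simplev S & ~~ (S <= X)%VS.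

Definition completely_reducible :=
  forall U, stablev U -> exists e : 'End(V),
    [/\ forall i v, e (a i v) = a i (e v), forall v, e v \in U &
        {in U, forall u, e u = u}].

Lemma stablev_add U W : stablev U -> stablev W -> stablev (U + W)%VS.
Proof.
move=> sU sW i _ /memv_addP[u uU [w wW ->]].
by rewrite linearD memv_add ?sU ?sW.
Qed.

Lemma stablev_cap U W : stablev U -> stablev W -> stablev (U :&: W)%VS.
Proof.
by move=> sU sW i u /memv_capP[uU uW]; apply/memv_capP; split; [apply: sU | apply: sW].
Qed.

(** A [W] maximal among the stable subspaces meeting [U] in 0 is a complement: a simple subspace
    outside U + W meets it in 0 and would enlarge [W]. *)
Lemma simple_generated_cr : simple_generated -> completely_reducible.
Proof.
move=> sg U sU; pose Q W := stablev W /\ (U :&: W = 0)%VS.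
have [|W [sW UW0] Wmax] := @exists_max_vspace _ _ Q 0%VS.
  by split; [move=> i u; rewrite !memv0 => /eqP->; rewrite linear0 | rewrite capv0].
have UWfull : (U + W = fullv)%VS.
  apply/eqP/negPn/negP => /eqP nfull.
  have [S [sS S0 Smin] SnUW] := sg _ (stablev_add sU sW) nfull.
  have SUW : (S :&: (U + W) = 0)%VS.
    have [||//|SE] := Smin (S :&: (U + W))%VS.
    - by apply: stablev_cap => //; apply: stablev_add.
    - exact: capvSl.
    - by case/negP: SnUW; rewrite -SE capvSr.
  have /Wmax : Q (W + S)%VS.
    split; first exact: stablev_add.
    apply/eqP; rewrite -subv0; apply/subvP => u /memv_capP[uU].
    case/memv_addP => w wW [s sS' uE].
    have s0 : s \in (S :&: (U + W))%VS.
      apply/memv_capP; split=> //; have -> : s = u - w by rewrite uE addrC addKr.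
      by rewrite memv_add ?memvN.
    rewrite -UW0; apply/memv_capP; split=> //.
    by move: s0; rewrite SUW memv0 uE => /eqP->; rewrite addr0.
  rewrite (geq_leqif (dimv_leqif_sup (addvSl W S))) subv_add => /andP[_ SW].
  by case/negP: SnUW; apply: subv_trans SW (addvSr _ _).
have WU0 : (W :&: U = 0)%VS by rewrite capvC.
exists (daddv_pi U W); split=> [i v|v|u uU].
- have [u uU [w wW ->]] : exists2 u, u \in U & exists2 w, w \in W & v = u + w.
    by apply/memv_addP; rewrite UWfull memvf.
  have pi0 x : x \in W -> daddv_pi U W x = 0.
    move=> xW; have := daddv_pi_add UW0 (_ : x \in U + W)%VS.
    rewrite (daddv_pi_id WU0 xW) UWfull memvf => /(_ isT)/eqP.
    by rewrite -subr_eq0 addrK => /eqP.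
  rewrite !linearD /= !(pi0 (a i w)) ?(pi0 w) ?sW // linear0 !addr0.
  by rewrite !daddv_pi_id ?sU.
- exact: memv_pi.
- exact: daddv_pi_id.
Qed.

Lemma exists_simplev X : stablev X -> X <> 0%VS ->
  exists2 S, simplev S & (S <= X)%VS.
Proof.
move=> sX X0; pose p k := `[< exists S, [/\ stablev S, S <> 0%VS, (S <= X)%VS & \dim S = k] >].
have /ex_minnP[k /asboolP[S [sS S0 SX Sk]] kmin] : exists k, p k.
  by exists (\dim X); apply/asboolP; exists X.
exists S => //; split=> // W sW WS.
have [->|/eqP W0] := eqVneq W 0%VS; [by left | right].
apply/eqP; rewrite eqEdim WS Sk; apply: kmin; apply/asboolP; exists W.
by split=> //; apply: subv_trans WS SX.
Qed.

Lemma simple_decomposition : completely_reducible ->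
  exists n (U : 'I_n -> {vspace V}),
    [/\ forall i, simplev (U i), directv (\sum_i U i) & (\sum_i U i)%VS = fullv].
Proof.
move=> cr; suff dec k X : stablev X -> (\dim X <= k)%N -> exists s : seq {vspace V},
    [/\ forall i, (i < size s)%N -> simplev (nth 0%VS s i), (\sum_(U <- s) U = X)%VS &
        (\sum_(U <- s) \dim U = \dim X)%N].
  have [|//|s [ss sE sd]] := dec (\dim {:V}) fullv.
    by move=> i u _; apply: memvf.
  exists (size s), (fun i => nth 0%VS s i).
  rewrite (big_nth 0%VS) big_mkord in sE; rewrite (big_nth 0%VS) big_mkord in sd.
  split=> [i||//]; first exact: ss.
  by rewrite directvE /= sE sd.
elim: k X => [|k IHk] X sX.
  rewrite leqn0 dimv_eq0 => /eqP->; exists [::].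
  by rewrite !big_nil dimv0.
have [->|/eqP X0] := eqVneq X 0%VS.
  by exists [::]; rewrite !big_nil dimv0.
have [S [sS S0 Smin] SX] := exists_simplev sX X0; have [e [ec eS eid]] := cr S sS.
have sker : stablev (lker e).
  by move=> i u; rewrite !memv_ker ec => /eqP->; rewrite linear0.
have SY : (S :&: (X :&: lker e) = 0)%VS.
  apply/eqP; rewrite -subv0; apply/subvP => u /memv_capP[uS /memv_capP[_]].
  by rewrite memv_ker eid // memv0.
have XE : (S + (X :&: lker e) = X)%VS.
  apply/eqP; rewrite eqEsubv subv_add SX capvSl /=; apply/subvP => x xX.
  rewrite -[x](subrKC (e x)); apply: memv_add => //; apply/memv_capP; split.
    by rewrite memvB // (subvP SX).
  by rewrite memv_ker linearB /= (eid (e x)) // subrr.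
have dimE := dimv_disjoint_sum SY; rewrite XE in dimE => Xk.
have [||s [ss sE sd]] := IHk (X :&: lker e)%VS; first exact: stablev_cap.
  have : (0 < \dim S)%N by rewrite lt0n dimv_eq0; apply/eqP.
  by lia.
exists (S :: s); rewrite !big_cons sE sd; split=> // -[|i] //=.
exact: ss.
Qed.

End Families.

Section Transfer.
Variables (K : fieldType) (I : Type).

Lemma simplev_img (V E : vectType K) (a : I -> 'End(V)) (c : I -> 'End(E))
    (iota : 'Hom(V, E)) (S : {vspace V}) :
  injective iota -> (forall i v, iota (a i v) = c i (iota v)) ->
  simplev a S -> simplev c (iota @: S)%VS.
Proof.
move=> inj eq_iota [sS S0 Smin]; have ker0 : lker iota == 0%VS by apply/lker0P.
split.
- by move=> i _ /memv_imgP[u uS ->]; rewrite -eq_iota memv_img ?sS.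
- move/eqP; rewrite -[X in _ == X](limg0 iota) (eq_limg_ker0 _ _ ker0).
  by move/eqP.
move=> W sW WS; have [||P PP] := @vspace_of_pred _ _ (fun v => iota v \in W).
- by rewrite linear0 mem0v.
- by move=> k u v uW vW; rewrite linearP memvD ?memvZ.
have WE : (iota @: P = W)%VS.
  apply/eqP; rewrite eqEsubv; apply/andP; split; apply/subvP => w.
    by case/memv_imgP => v /PP vW ->.
  by move=> wW; have /memv_imgP[v vS wE] := subvP WS _ wW;
    rewrite wE memv_img //; apply/PP; rewrite -wE.
have [||P0|PS] := Smin P; rewrite -?WE.
- by move=> i v /PP vW; apply/PP; rewrite eq_iota sW.
- by rewrite -(limg_ker0 _ _ ker0) WE.
- by left; rewrite P0 limg0.
- by right; rewrite PS.
Qed.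

Lemma simple_generated_sum (V1 V2 E : vectType K) (a1 : I -> 'End(V1))
    (a2 : I -> 'End(V2)) (c : I -> 'End(E)) (f1 : 'Hom(V1, E)) (f2 : 'Hom(V2, E)) :
  injective f1 -> (forall i v, f1 (a1 i v) = c i (f1 v)) ->
  injective f2 -> (forall i v, f2 (a2 i v) = c i (f2 v)) ->
  (limg f1 + limg f2)%VS = fullv ->
  simple_generated a1 -> simple_generated a2 -> simple_generated c.
Proof.
have key (V : vectType K) (a : I -> 'End(V)) (f : 'Hom(V, E)) X :
    injective f -> (forall i v, f (a i v) = c i (f v)) -> simple_generated a ->
    stablev c X -> ~~ (limg f <= X)%VS -> exists2 S, simplev c S & ~~ (S <= X)%VS.
  move=> inj eqf sg sX nfX; have [|k u v uX vX|P PP] :=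
    @vspace_of_pred _ _ (fun v => f v \in X).
  - by rewrite linear0 mem0v.
  - by rewrite linearP memvD ?memvZ.
  have [||S sS SP] := sg P.
  - by move=> i v /PP vX; apply/PP; rewrite eqf sX.
  - move=> PE; case/negP: nfX; apply/subvP => _ /memv_imgP[v vV ->].
    by apply/PP; rewrite PE memvf.
  exists (f @: S)%VS; first exact: simplev_img eqf sS.
  by apply: contra SP => /subvP SX; apply/subvP => v vS; apply/PP/SX/memv_img.
move=> i1 e1 i2 e2 full sg1 sg2 X sX nX.
have [f1X|f1X] := boolP (limg f1 <= X)%VS; last exact: key sg1 sX f1X.
have [f2X|f2X] := boolP (limg f2 <= X)%VS; last exact: key sg2 sX f2X.
by case: nX; apply/eqP; rewrite eqEsubv subvf -full subv_add f1X.
Qed.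

Lemma completely_reducible_retract (V E : vectType K) (a : I -> 'End(V))
    (c : I -> 'End(E)) (f : 'Hom(V, E)) (p : 'Hom(E, V)) :
  (forall v, p (f v) = v) -> (forall i v, f (a i v) = c i (f v)) ->
  (forall i w, p (c i w) = a i (p w)) ->
  completely_reducible c -> completely_reducible a.
Proof.
move=> pK eqf eqp cr U sU; have [|e [ec eU eid]] := cr (f @: U)%VS.
  by move=> i _ /memv_imgP[u uU ->]; rewrite -eqf memv_img ?sU.
exists (p \o e \o f)%VF; split=> [i v|v|u uU]; rewrite !comp_lfunE.
- by rewrite eqf ec eqp.
- by have /memv_imgP[u uU ->] := eU (f v); rewrite pK.
- by rewrite eid ?memv_img.
Qed.

End Transfer.

Section AdLfun.
Variables (K : fieldType) (V W : vectType K).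

Lemma hom_ad_linear (y : 'End(W)) (x : 'End(V)) :
  linear (fun f : 'Hom(V, W) => (y \o f)%VF - (f \o x)%VF).
Proof.
move=> k f g; rewrite comp_lfunDr comp_lfunDl -comp_lfunZr -comp_lfunZl.
by rewrite scalerBr opprD addrACA.
Qed.

Definition hom_ad y x : 'End('Hom(V, W)) := mk_lfun (hom_ad_linear y x).

Lemma hom_adE y x (f : 'Hom(V, W)) v : hom_ad y x f v = y (f v) - f (x v).
Proof. by rewrite mk_lfunE add_lfunE opp_lfunE !comp_lfunE. Qed.
End AdLfun.

Import passmx.

Lemma completely_reducible_ad (C : numClosedFieldType) (V : vectType C)
    (I : Type) (a : I -> 'End(V)) :
  completely_reducible a -> completely_reducible (fun i => hom_ad (a i) (a i)).
Proof.
move=> cr; pose e := vbasis {:V}; have eb : basis_of {:V} e by apply: vbasisP.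
pose mx (f : 'End(V)) := mxof e e f.
pose lf (A : 'M_(\dim {:V})) : 'End(V) := hommx e e A.
have mxK : cancel mx lf by apply: mxofK.
have lfK : cancel lf mx by apply: hommxK.
have mxM f g : mx (f \o g)%VF = mx g *m mx f by apply: mxof_comp.
have rVofE (f : 'End(V)) v : rVof e (f v) = rVof e v *m mx f.
  exact: rVof_app.
have rVofK := rVofK eb; have vecofK := vecofK eb.
pose S x := exists i, x = mx (a i).
have Scr : completely_reducible_mx S.
  move=> U SU.
  have memU v : v \in vsof e U = (rVof e v <= U)%MS.
    apply/memv_imgP/submxP => [[w _ ->]|[D DE]].
      by exists (rVof e w); rewrite rVofE [mx _]lfK.
    exists (vecof e D); first exact: memvf.
    by rewrite -[LHS]rVofK DE; apply: vecof_mul.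
  have [|p [pc pU pid]] := cr (vsof e U).
    move=> i u; rewrite !memU rVofE => uU.
    by apply: submx_trans (submxMr _ uU) (SU _ _); exists i.
  exists (mx p); split.
  - move=> _ [i ->]; rewrite /comm_mx -!mxM.
    by congr mx; apply/lfunP => v; rewrite !comp_lfunE pc.
  - apply/row_subP => i.
    by rewrite rowE -[delta_mx 0 i]vecofK -rVofE -memU.
  - apply/row_matrixP => i; rewrite row_mul -[row i U]vecofK -rVofE pid //.
    by rewrite memU vecofK row_sub.
have mx_ad i f : mx (hom_ad (a i) (a i) f) = mxbr (mx f) (mx (a i)).
  by rewrite mk_lfunE /mxbr -!mxM /mx linearB.
have ad_lf i A : hom_ad (a i) (a i) (lf A) = lf (mxbr A (mx (a i))).
  by apply: (can_inj mxK); rewrite mx_ad !lfK.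
move=> U sU.
have [|c u v uU vU|M MP] := @mx_of_pred _ _ (fun v => lf (vec_mx v) \in U).
- by rewrite /lf !linear0 mem0v.
- by rewrite /lf !linearP memvD ?memvZ.
have [_ [_ [i ->] ->]|E [Ec EM ME]] := completely_reducible_Ad Scr (U := M).
  apply/row_subP => k; rewrite row_mul -[row k M]vec_mxK mul_mxvec_Ad.
  by apply/MP; rewrite mxvecK -ad_lf sU //; apply/MP; rewrite row_sub.
have lin : linear (fun f : 'End(V) => lf (vec_mx (mxvec (mx f) *m E))).
  by move=> c f g; rewrite /mx /lf linearP linearP mulmxDl -scalemxAl !linearP.
exists (mk_lfun lin); split=> [i f|f|f fU]; rewrite !(mk_lfunE lin).
- rewrite mx_ad -mul_mxvec_Ad -mulmxA (Ec (Ad (mx (a i)))); last first.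
    by exists (mx (a i)) => //; exists i.
  by rewrite mulmxA -[mxvec _ *m E]vec_mxK mul_mxvec_Ad mxvecK -ad_lf vec_mxK.
- by apply/MP; apply: submx_trans EM; apply: submxMl.
- have /submxP[D DE] : (mxvec (mx f) <= M)%MS by apply/MP; rewrite mxvecK mxK.
  by rewrite DE -mulmxA ME -DE mxvecK mxK.
Qed.

(** ['Hom(V, W)] is a block of the endomorphisms of [V * W], hence an equivariant retract of
    them. *)
Lemma completely_reducible_hom (C : numClosedFieldType) (V W : vectType C)
    (I : Type) (a : I -> 'End(V)) (b : I -> 'End(W)) :
  simple_generated a -> simple_generated b ->
  completely_reducible (fun i => hom_ad (b i) (a i)).
Proof.
move=> sa sb.
have lc i : linear (fun p : V * W => (a i p.1, b i p.2)).
  by move=> k p q; rewrite !linearP.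
pose c i : 'End((V * W)%type) := mk_lfun (lc i).
have l1 : linear (fun v : V => (v, 0) : V * W).
  by move=> k u v; congr pair; rewrite /= scaler0 addr0.
have l2 : linear (fun w : W => (0, w) : V * W).
  by move=> k u v; congr pair; rewrite /= scaler0 addr0.
have p1 : linear (fun p : V * W => p.1) by [].
have p2 : linear (fun p : V * W => p.2) by [].
pose i1 := mk_lfun l1; pose i2 := mk_lfun l2.
pose q1 := mk_lfun p1; pose q2 := mk_lfun p2.
have sc : simple_generated c.
  apply: (simple_generated_sum (f1 := i1) (f2 := i2)) sa sb.
  - by move=> u v; rewrite !mk_lfunE => -[].
  - by move=> i v; rewrite !mk_lfunE /= linear0.
  - by move=> u v; rewrite !mk_lfunE => -[].
  - by move=> i v; rewrite !mk_lfunE /= linear0.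
  - apply/eqP; rewrite eqEsubv subvf; apply/subvP => -[v w] _.
    have -> : (v, w) = i1 v + i2 w.
      by rewrite !mk_lfunE; congr pair; rewrite /= ?addr0 ?add0r.
    by rewrite memv_add ?memv_img ?memvf.
have lf : linear (fun f : 'Hom(V, W) => (i2 \o f \o q1)%VF).
  move=> k f g; apply/lfunP => p.
  by rewrite add_lfunE scale_lfunE !comp_lfunE add_lfunE scale_lfunE linearP.
have lp : linear (fun f : 'End((V * W)%type) => (q2 \o f \o i1)%VF).
  move=> k f g; apply/lfunP => p.
  by rewrite add_lfunE scale_lfunE !comp_lfunE add_lfunE scale_lfunE linearP.
apply: (completely_reducible_retract (f := mk_lfun lf) (p := mk_lfun lp))
  (completely_reducible_ad (simple_generated_cr sc)).
- move=> f; apply/lfunP => v; rewrite (mk_lfunE lp) (mk_lfunE lf). by rewrite !comp_lfunE !mk_lfunE.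
- move=> i f; apply/lfunP => -[v w].
  rewrite !(mk_lfunE lf) hom_adE !comp_lfunE hom_adE !mk_lfunE /=.
  by rewrite linear0; congr pair; apply/esym/subr0.
- move=> i f; apply/lfunP => v.
  rewrite !(mk_lfunE lp) hom_adE !comp_lfunE hom_adE !mk_lfunE /= linear0.
  by [].
Qed.

(** * Parities and super Hom spaces *)

Section Parity.
Variables (K : numFieldType) (V : vectType K) (part : bool -> {vspace V}).

Definition even_proj : 'End(V) := locked (daddv_pi (part false) (part true)).
Definition odd_proj : 'End(V) := locked (daddv_pi (part true) (part false)).
Definition parity_op : 'End(V) := locked (even_proj - odd_proj).

Lemma mem_even_proj v : even_proj v \in part false.
Proof. by rewrite /even_proj -lock memv_pi. Qed.

Lemma mem_odd_proj v : odd_proj v \in part true.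
Proof. by rewrite /odd_proj -lock memv_pi. Qed.

Lemma parity_op_sub v : parity_op v = even_proj v - odd_proj v.
Proof. by rewrite /parity_op -lock add_lfunE opp_lfunE. Qed.


Hypothesis part_direct : directv (part false + part true).
Hypothesis part_full : (part false + part true)%VS = fullv.

Lemma part_decomp v : v = even_proj v + odd_proj v.
Proof.
rewrite /even_proj /odd_proj -!lock daddv_pi_add ?part_full ?memvf //.
exact/directv_addP.
Qed.

Lemma even_projE i v : v \in part i -> even_proj v = if i then 0 else v.
Proof.
have cap0 : (part false :&: part true = 0)%VS by apply/directv_addP.
case: i => vi; last by rewrite /even_proj -lock daddv_pi_id.
have := part_decomp v; rewrite /odd_proj -lock daddv_pi_id //; last by rewrite capvC.
by move/eqP; rewrite -subr_eq0 opprD addrCA subrr addr0 oppr_eq0 => /eqP.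
Qed.

Lemma odd_projE i v : v \in part i -> odd_proj v = if i then v else 0.
Proof.
move=> vi; have := part_decomp v; rewrite (even_projE vi).
case: (i) => /=; first by rewrite add0r.
by rewrite -{1}[v]addr0 => /addrI.
Qed.

Lemma parity_opE i v : v \in part i -> parity_op v = (-1) ^+ i *: v.
Proof.
move=> vi; rewrite parity_op_sub (even_projE vi) (odd_projE vi).
by case: (i); rewrite ?sub0r ?subr0 ?expr0 ?expr1 ?scaleN1r ?scale1r.
Qed.

Let parity_op_even v : parity_op (even_proj v) = even_proj v.
Proof. by rewrite (parity_opE (mem_even_proj v)) scale1r. Qed.

Let parity_op_odd v : parity_op (odd_proj v) = - odd_proj v.
Proof. by rewrite (parity_opE (mem_odd_proj v)) scaleN1r. Qed.

Lemma parity_opK v : parity_op (parity_op v) = v.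
Proof.
by rewrite [parity_op v]parity_op_sub linearB /= parity_op_even parity_op_odd
  opprK -part_decomp.
Qed.

Lemma parity_opP i v : (v \in part i) = (parity_op v == (-1) ^+ i *: v).
Proof.
apply/idP/eqP => [/parity_opE //|].
rewrite parity_op_sub {3}[v]part_decomp.
have neq (w : V) : w = - w -> w = 0.
  move/eqP; rewrite -addr_eq0 -mulr2n -scaler_nat scaler_eq0 pnatr_eq0 /=.
  by move/eqP.
case: i; rewrite ?expr0 ?expr1 ?scaleN1r ?scale1r ?opprD.
  by move/addIr/neq => E; rewrite [v]part_decomp E add0r; exact: mem_odd_proj.
by move/addrI/esym/neq => E; rewrite [v]part_decomp E addr0; exact: mem_even_proj.
Qed.
End Parity.

Section Involution.
Variables (K : numFieldType) (V : vectType K) (c : 'End(V)).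
Hypothesis cK : forall v, c (c v) = v.

Definition eigenpart (i : bool) : {vspace V} := lker (c - (-1) ^+ i *: \1%VF).

Lemma mem_eigenpart i v : (v \in eigenpart i) = (c v == (-1) ^+ i *: v).
Proof.
by rewrite memv_ker add_lfunE opp_lfunE scale_lfunE id_lfunE subr_eq0.
Qed.

Lemma eigenpart_direct : directv (eigenpart false + eigenpart true).
Proof.
apply/directv_addP/eqP; rewrite -subv0; apply/subvP => v /memv_capP[].
rewrite !mem_eigenpart expr0 expr1 scale1r scaleN1r => /eqP-> /eqP.
by move/eqP; rewrite -addr_eq0 -mulr2n -scaler_nat scaler_eq0 pnatr_eq0 memv0.
Qed.

Lemma eigenpart_full : (eigenpart false + eigenpart true)%VS = fullv.
Proof.
apply/eqP; rewrite eqEsubv subvf; apply/subvP => v _.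
have -> : v = 2%:R^-1 *: (v + c v) + 2%:R^-1 *: (v - c v).
  rewrite -scalerDr addrACA subrr addr0 -mulr2n -scaler_nat scalerA mulVf ?scale1r //.
  by rewrite pnatr_eq0.
apply: memv_add; apply: memvZ; rewrite mem_eigenpart.
  by rewrite [c _]linearD /= cK expr0 scale1r addrC.
by rewrite [c _]linearB /= cK expr1 scaleN1r opprB.
Qed.

Lemma parity_op_eigenpart : parity_op eigenpart = c.
Proof.
apply/lfunP => v; rewrite parity_op_sub.
rewrite {3}[v](part_decomp eigenpart_direct eigenpart_full) linearD /=.
have := mem_even_proj eigenpart v; have := mem_odd_proj eigenpart v.
by rewrite !mem_eigenpart expr0 expr1 scale1r scaleN1r => /eqP-> /eqP->.
Qed.
End Involution.

Lemma lfun_linE (K : fieldType) (U V : vectType K) k (f h : 'Hom(U, V)) v :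
  (k *: f + h) v = k *: f v + h v.
Proof. by rewrite add_lfunE scale_lfunE. Qed.

Lemma linear_comb_sub3 (K : fieldType) (V : lmodType K) (k : K) (a a' b b' c c' : V) :
  k *: a + a' - (k *: b + b') - (k *: c + c') =
  k *: (a - b - c) + (a' - b' - c').
Proof. by rewrite !scalerBr !opprD (addrACA (k *: a)) [LHS]addrACA. Qed.

(** [B] and [C] are the mixed terms, with one element acting on the target and the other on the
    source; [B] cancels because the sign squares to 1. *)
Lemma super_bracket_cancel (K : fieldType) (V : lmodType K) (s : K)
    (X Y B C D H : V) : s * s = 1 ->
  X - s *: Y - (H - s *: D) =
  X - B - s *: (C - D) - s *: (Y - C - s *: (B - H)).
Proof.
move=> ss; rewrite !scalerBr !scalerA ss !scale1r !opprB.
by rewrite [RHS]addrACA !subrKA [LHS]addrACA [RHS]addrACA [- H - _]addrC.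
Qed.

Section HomAction.
Variables (K : numFieldType) (G M N : vectType K) (gpart : bool -> {vspace G}).
Variables (ad : 'Hom(G, 'End(G))) (aM : 'Hom(G, 'End(M))) (aN : 'Hom(G, 'End(N))).
Variables (sM : 'End(M)) (sN : 'End(N)).
Local Notation H := 'Hom(M, N).

Lemma hom_conj_linear : linear (fun f : H => (sN \o f \o sM)%VF).
Proof.
move=> k f h; apply/lfunP => v.
by rewrite [RHS]lfun_linE !comp_lfunE lfun_linE linearP.
Qed.

Definition hom_conj : 'End(H) := mk_lfun hom_conj_linear.

Lemma hom_conjE f v : hom_conj f v = sN (f (sM v)).
Proof. by rewrite mk_lfunE !comp_lfunE. Qed.

Hypothesis sMK : forall v, sM (sM v) = v.
Hypothesis sNK : forall v, sN (sN v) = v.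
Hypothesis gpart_direct : directv (gpart false + gpart true).
Hypothesis gpart_full : (gpart false + gpart true)%VS = fullv.
Hypothesis sM_act : forall i x v, x \in gpart i ->
  sM (aM x v) = (-1) ^+ i *: aM x (sM v).
Hypothesis sN_act : forall i x v, x \in gpart i ->
  sN (aN x v) = (-1) ^+ i *: aN x (sN v).
Hypothesis ad_parity : forall i j x y, x \in gpart i -> y \in gpart j ->
  ad x y \in gpart (i (+) j).
Hypothesis aM_bracket : forall i j x y v, x \in gpart i -> y \in gpart j ->
  aM (ad x y) v = aM x (aM y v) - (-1) ^+ (i && j) *: aM y (aM x v).
Hypothesis aN_bracket : forall i j x y v, x \in gpart i -> y \in gpart j ->
  aN (ad x y) v = aN x (aN y v) - (-1) ^+ (i && j) *: aN y (aN x v).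

Lemma hom_conjK f : hom_conj (hom_conj f) = f.
Proof. by apply/lfunP => v; rewrite !hom_conjE ?sMK ?sNK. Qed.

(** The supercommutator. The sign (-1)^(|x||f|) is 1 for the even part of [x]; for the odd part it
    is absorbed by [hom_conj f], which is [f] or [- f] according to the parity of [f]. *)
Definition hom_act_fun (x : G) (f : H) : H :=
  (aN x \o f)%VF - (f \o aM (even_proj (gpart) x))%VF
    - (hom_conj f \o aM (odd_proj (gpart) x))%VF.

Lemma hom_act_funE x f v : hom_act_fun x f v = aN x (f v)
  - f (aM (even_proj (gpart) x) v)
  - hom_conj f (aM (odd_proj (gpart) x) v).
Proof.
have subE (A B C : H) w : (A - B - C) w = A w - B w - C w.
  by rewrite !(add_lfunE, opp_lfunE).
rewrite /hom_act_fun.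
rewrite [LHS]subE.
congr (_ - _ - _).
- exact: comp_lfunE.
- exact: comp_lfunE.
- exact: comp_lfunE.
Qed.

Lemma hom_act_fun_linear x : linear (hom_act_fun x).
Proof.
move=> k f h; apply/lfunP => v; rewrite [RHS]lfun_linE !hom_act_funE.
rewrite [hom_conj _]linearP /= !(lfun_linE k f h) (lfun_linE k (hom_conj f)).
rewrite (linearP (aN x)); exact: linear_comb_sub3.
Qed.

Lemma hom_act_linear : linear (fun x => mk_lfun (hom_act_fun_linear x)).
Proof.
move=> k x y; apply/lfunP => f; rewrite [RHS]lfun_linE !mk_lfunE.
apply/lfunP => v; rewrite [RHS]lfun_linE !hom_act_funE.
rewrite (linearP (aN)) (linearP (even_proj (gpart))).
rewrite (linearP (odd_proj (gpart))) !(linearP (aM)).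
rewrite (lfun_linE _ (aN x)).
rewrite (lfun_linE _ (aM (even_proj (gpart) x))).
rewrite (lfun_linE _ (aM (odd_proj (gpart) x))).
rewrite (linearP f) (linearP (hom_conj f)); exact: linear_comb_sub3.
Qed.

Definition hom_act : 'Hom(G, 'End(H)) := mk_lfun hom_act_linear.

Lemma hom_act_def x f : hom_act x f = hom_act_fun x f.
Proof. by rewrite !mk_lfunE. Qed.

Definition conj_if (i : bool) (f : H) := if i then hom_conj f else f.

Lemma hom_actE i x f v : x \in gpart i ->
  hom_act x f v = aN x (f v) - conj_if i f (aM x v).
Proof.
move=> xi; rewrite hom_act_def hom_act_funE.
rewrite (even_projE gpart_direct gpart_full xi).
rewrite (odd_projE gpart_direct gpart_full xi).
by case: (i); rewrite linear0 zero_lfunE linear0 subr0.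
Qed.

Lemma hom_conj_act j y f : y \in gpart j ->
  hom_conj (hom_act y f) = (-1) ^+ j *: hom_act y (hom_conj f).
Proof.
move=> yj; apply/lfunP => v; rewrite scale_lfunE hom_conjE !(hom_actE _ _ yj).
rewrite linearB /= (sN_act _ yj) hom_conjE scalerBr; congr (_ - _).
have -> : aM y (sM v) = (-1) ^+ j *: sM (aM y v).
  by rewrite (sM_act _ yj) scalerA -expr2 sqrr_sign scale1r.
rewrite !linearZ /=; congr (_ *: _).
by case: (j); rewrite /= ?hom_conjE // !hom_conjE ?sMK ?sNK.
Qed.

Lemma conj_if_act i j y f : y \in gpart j ->
  conj_if i (hom_act y f) = (-1) ^+ (i && j) *: hom_act y (conj_if i f).
Proof. by case: i => yj /=; rewrite ?(hom_conj_act _ yj) // scale1r. Qed.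

Lemma hom_act_parity i j x f : x \in gpart i -> f \in eigenpart hom_conj j ->
  hom_act x f \in eigenpart hom_conj (i (+) j).
Proof.
move=> xi; rewrite !mem_eigenpart (hom_conj_act _ xi) => /eqP->.
by rewrite linearZ /= scalerA signr_addb.
Qed.

Lemma hom_act_bracket i j x y f : x \in gpart i -> y \in gpart j ->
  hom_act (ad x y) f =
    hom_act x (hom_act y f) - (-1) ^+ (i && j) *: hom_act y (hom_act x f).
Proof.
move=> xi yj; apply/lfunP => v.
rewrite add_lfunE opp_lfunE scale_lfunE (hom_actE _ _ (ad_parity xi yj)).
rewrite (aM_bracket _ xi yj) (aN_bracket _ xi yj) (hom_actE _ _ xi) (hom_actE (hom_act x f) _ yj).
rewrite (conj_if_act _ _ yj) (conj_if_act _ _ xi) !scale_lfunE.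
rewrite !(hom_actE _ _ xi) !(hom_actE _ _ yj).
have cc k l : conj_if k (conj_if l f) = conj_if (k (+) l) f.
  by case: k; case: l => //=; rewrite hom_conjK.
rewrite !cc [j && i]andbC [j (+) i]addbC.
rewrite (linearB (aN x)) (linearB (aN y)) (linearB (conj_if (i (+) j) f)).
rewrite (linearZ_LR (conj_if (i (+) j) f)) /=; by apply: super_bracket_cancel; rewrite -expr2 sqrr_sign.
Qed.

End HomAction.

(** * Partial traces *)

Section Retraction.
Variables (K : numFieldType) (G P N : vectType K) (gpart : bool -> {vspace G}).
Variables (aP : 'Hom(G, 'End(P))) (aN : 'Hom(G, 'End(N))).
Variables (sP : 'End(P)) (sN : 'End(N)).

Hypothesis gpart_direct : directv (gpart false + gpart true).
Hypothesis gpart_full : (gpart false + gpart true)%VS = fullv.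
Hypothesis sPK : forall v, sP (sP v) = v.
Hypothesis sNK : forall v, sN (sN v) = v.
Hypothesis sP_act : forall i x v, x \in gpart i ->
  sP (aP x v) = (-1) ^+ i *: aP x (sP v).
Hypothesis sN_act : forall i x v, x \in gpart i ->
  sN (aN x v) = (-1) ^+ i *: aN x (sN v).

(* D plays the dual of P and X the module Hom(D, P), i.e. P (x) P; dv and xv
   are the evaluations. Keeping D and X abstract avoids conversions between
   nested vectType structures. *)
Local Notation T := (K^o : vectType K).
Variables (D X : vectType K).
Variables (dv : 'Hom(D, 'Hom(P, T))) (dv' : 'Hom('Hom(P, T), D)).
Variables (xv : 'Hom(X, 'Hom(D, P))) (xv' : 'Hom('Hom(D, P), X)).
Variables (sD : 'End(D)) (aD : 'Hom(G, 'End(D))).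
Variables (sX : 'End(X)) (aX : 'Hom(G, 'End(X))).
Hypothesis dvK : forall f, dv (dv' f) = f.
Hypothesis dv'K : forall xi, dv' (dv xi) = xi.
Hypothesis xvK : forall f, xv (xv' f) = f.
Hypothesis xv'K : forall th, xv' (xv th) = th.
Hypothesis dualE : forall xi v, dv (sD xi) v = dv xi (sP v).
Hypothesis dual_actE : forall i x xi v, x \in gpart i ->
  dv (aD x xi) v = - dv xi ((if i then sP else \1%VF) (aP x v)).
Hypothesis tensE : forall th xi, xv (sX th) xi = sP (xv th (sD xi)).
Hypothesis tens_act_even : forall x th xi, x \in gpart false ->
  xv (aX x th) xi = aP x (xv th xi) - xv th (aD x xi).
Hypothesis tens_act_odd : forall x th xi, x \in gpart true ->
  xv (aX x th) xi = aP x (xv th xi) - sP (xv th (sD (aD x xi))).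

Lemma dual_ext xi eta : (forall v, dv xi v = dv eta v) -> xi = eta.
Proof. by move=> E; apply: (can_inj dv'K); apply/lfunP. Qed.

Lemma tens_ext th ze : (forall xi, xv th xi = xv ze xi) -> th = ze.
Proof. by move=> E; apply: (can_inj xv'K); apply/lfunP. Qed.

Lemma dualK xi : sD (sD xi) = xi.
Proof. by apply: dual_ext => v; rewrite !dualE sPK. Qed.

Section Action.
Variables (Q : vectType K) (aQ : 'Hom(G, 'End(Q))) (sQ : 'End(Q)).
Local Notation A := 'Hom(Q, X).
Local Notation sA := (hom_conj sQ sX).
Local Notation aA := (hom_act gpart aQ aX sQ sX).

Lemma tri_conjE (F : A) q xi : xv (sA F q) xi = sP (xv (F (sQ q)) (sD xi)).
Proof. by rewrite hom_conjE tensE. Qed.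

Lemma tri_act_even x (F : A) q xi : x \in gpart false ->
  xv (aA x F q) xi = aP x (xv (F q) xi) - xv (F q) (aD x xi) - xv (F (aQ x q)) xi.
Proof.
move=> xg; rewrite (hom_actE aQ aX sQ sX gpart_direct gpart_full _ _ xg).
by rewrite linearB /= add_lfunE opp_lfunE tens_act_even.
Qed.

Lemma tri_act_odd x (F : A) q xi : x \in gpart true ->
  xv (aA x F q) xi = aP x (xv (F q) xi) - sP (xv (F q) (sD (aD x xi)))
    - xv (sA F (aQ x q)) xi.
Proof.
move=> xg; rewrite (hom_actE aQ aX sQ sX gpart_direct gpart_full _ _ xg).
by rewrite linearB /= add_lfunE opp_lfunE tens_act_odd.
Qed.
End Action.

Lemma contraction_linear1 (p : P) (q : P) :
  linear (fun xi : D => (dv xi (sP q) : K) *: p).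
Proof. by move=> k xi eta; rewrite linearP lfun_linE scalerDl scalerA. Qed.

Lemma contraction_linear2 (p : P) :
  linear (fun q => xv' (mk_lfun (contraction_linear1 p q))).
Proof.
move=> k q q'; rewrite -linearP; congr (xv' _); apply/lfunP => xi.
by rewrite lfun_linE !mk_lfunE !linearP scalerDl scalerA.
Qed.

Lemma contraction_linear3 : linear (fun p => mk_lfun (contraction_linear2 p)).
Proof.
move=> k p p'; apply/lfunP => q; rewrite lfun_linE !mk_lfunE -linearP.
congr (xv' _); apply/lfunP => xi.
rewrite lfun_linE !mk_lfunE scalerDr !scalerA; congr (_ *: _ + _).
exact: mulrC.
Qed.

(* p maps to q |-> (xi |-> xi (sP q) p), i.e. to (q |-> p (x) q) under the
   identification of P (x) P with Hom(P^*, P). *)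
Definition contraction : 'Hom(P, 'Hom(P, X)) := mk_lfun contraction_linear3.

Lemma contractionE p q xi : xv (contraction p q) xi = (dv xi (sP q) : K) *: p.
Proof. by rewrite !mk_lfunE xvK mk_lfunE. Qed.

Lemma contraction_conj p : contraction (sP p) = hom_conj sP sX (contraction p).
Proof.
apply/lfunP => q; apply: tens_ext => xi.
by rewrite tri_conjE !contractionE dualE linearZ sPK.
Qed.

Lemma contraction_act i x p : x \in gpart i ->
  contraction (aP x p) = hom_act gpart aP aX sP sX x (contraction p).
Proof.
case: i => xg; apply/lfunP => q; apply: tens_ext => xi.
  rewrite tri_act_odd // tri_conjE !contractionE !dualE (dual_actE _ _ xg).
  by rewrite !linearZ /= !sPK scaleNr scalerN opprK addrK.
rewrite tri_act_even // !contractionE (dual_actE _ _ xg) id_lfunE.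
by rewrite (sP_act _ xg) expr0 scale1r linearZ /= scaleNr opprK addrK.
Qed.

Variable Phi : 'Hom(P, 'Hom(N, X)).
Local Notation aA := (hom_act gpart aN aX sN sX).
Hypothesis Phi_act : forall x p, Phi (aP x p) = aA x (Phi p).
Hypothesis Phi_conj : forall p, Phi (sP p) = hom_conj sN sX (Phi p).
Variable iota : 'Hom(P, N).
Hypothesis iota_conj : forall p, iota (sP p) = sN (iota p).
Hypothesis Phi_iota : forall p q xi,
  xv (Phi p (iota q)) xi = (dv xi (sP q) : K) *: p.

Local Notation b := (vbasis {:P}).
Let eps j : D := dv' (linfun (coord b j : P -> T)).

Let epsE j p : dv (eps j) p = coord b j p.
Proof. by rewrite dvK lfunE. Qed.

Let sum_eps p : p = \sum_j (dv (eps j) p : K) *: b`_j.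
Proof.
by rewrite {1}(coord_vbasis (memvf p)); apply: eq_bigr => j _; rewrite epsE.
Qed.

Let sum_dual (xi : D) : xi = \sum_(j < \dim {:P}) (dv xi b`_j : K) *: eps j.
Proof.
apply: dual_ext => p; rewrite linear_sum sum_lfunE {1}(sum_eps p) linear_sum.
by apply: eq_bigr => j _; rewrite !linearZ scale_lfunE /= [LHS]mulrC.
Qed.

Lemma partial_trace_linear (h : 'End(P)) :
  linear (fun n => \sum_(j < \dim {:P}) xv (Phi (h b`_j) n) (eps j)).
Proof.
move=> k m n; rewrite scaler_sumr -big_split; apply: eq_bigr => j _.
by rewrite !linearP lfun_linE.
Qed.

(** The twist [h] covers the trace ([\1]) and the supertrace ([sP]) at once, and absorbs the
    operators that appear when [x] is moved through the sum. *)
Definition partial_trace h : 'Hom(N, P) := mk_lfun (partial_trace_linear h).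

Lemma partial_traceE h n :
  partial_trace h n = \sum_(j < \dim {:P}) xv (Phi (h b`_j) n) (eps j).
Proof. by rewrite mk_lfunE. Qed.

(** The sum of the tensors of [b]_j with [eps j] does not depend on the basis, so an operator on the
    dual basis can be moved to the basis. *)
Lemma partial_trace_comp (h k : 'End(P)) n :
  \sum_(j < \dim {:P}) xv (Phi (h b`_j) n) (dv' (dv (eps j) \o k)%VF) =
  partial_trace (h \o k) n.
Proof.
rewrite partial_traceE.
under eq_bigr => j _ do rewrite [dv' (dv (eps j) \o k)%VF]sum_dual linear_sum.
rewrite exchange_big; apply: eq_bigr => j _ /=.
rewrite comp_lfunE (sum_eps (k b`_j)) !linear_sum !sum_lfunE linear_sum sum_lfunE.
by apply: eq_bigr => l _; rewrite !linearZ !scale_lfunE dvK comp_lfunE linearZ scale_lfunE.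
Qed.

Lemma partial_traceN h n : partial_trace (- h) n = - partial_trace h n.
Proof.
rewrite !partial_traceE -sumrN; apply: eq_bigr => j _.
by rewrite opp_lfunE linearN opp_lfunE linearN opp_lfunE.
Qed.

Lemma sP_Phi p n xi : sP (xv (Phi p n) xi) = xv (Phi (sP p) (sN n)) (sD xi).
Proof. by rewrite Phi_conj tri_conjE sNK dualK. Qed.

Lemma partial_trace_conj h n :
  sP (partial_trace h n) = partial_trace (sP \o h \o sP) (sN n).
Proof.
rewrite -partial_trace_comp partial_traceE linear_sum; apply: eq_bigr => j _.
rewrite /= sP_Phi comp_lfunE; congr (xv _ _).
by apply: dual_ext => p; rewrite dualE dvK comp_lfunE.
Qed.

Lemma partial_trace_even x h n : x \in gpart false ->
  aP x (partial_trace h n) = partial_trace (aP x \o h) n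
     - partial_trace (h \o aP x) n + partial_trace h (aN x n).
Proof.
move=> xg; rewrite -partial_trace_comp !partial_traceE linear_sum -sumrB -big_split.
apply: eq_bigr => j _ /=; rewrite comp_lfunE Phi_act tri_act_even //.
have -> : aD x (eps j) = - dv' (dv (eps j) \o aP x)%VF.
  apply: dual_ext => p.
  by rewrite (dual_actE _ _ xg) (linearN dv) /= opp_lfunE (dvK (_ \o _)%VF) comp_lfunE id_lfunE.
by rewrite linearN opprK addrAC subrK addrK.
Qed.

Lemma partial_trace_odd x h n : x \in gpart true ->
  aP x (partial_trace h n) = partial_trace (aP x \o h) n
     - partial_trace (sP \o h \o (sP \o aP x)) (sN n)
     + partial_trace (sP \o h) (aN x n).
Proof.
move=> xg; rewrite -partial_trace_comp !partial_traceE linear_sum -sumrB -big_split.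
apply: eq_bigr => j _ /=; rewrite !comp_lfunE Phi_act tri_act_odd //.
rewrite -Phi_conj sP_Phi dualK.
have -> : aD x (eps j) = - dv' (dv (eps j) \o (sP \o aP x))%VF.
  apply: dual_ext => p.
  by rewrite (dual_actE _ _ xg) (linearN dv) /= opp_lfunE (dvK (_ \o _)%VF) !comp_lfunE.
by rewrite linearN opprK addrAC subrK addrK.
Qed.

Lemma partial_trace_iota h q : partial_trace h (iota q) = h (sP q).
Proof.
rewrite partial_traceE (sum_eps (sP q)) linear_sum.
by apply: eq_bigr => j _; rewrite Phi_iota linearZ.
Qed.

Lemma exists_super_retraction : exists r : 'Hom(N, P),
  [/\ forall q, r (iota q) = q, forall n, r (sN n) = sP (r n) &
      forall i x n, x \in gpart i -> r (aN x n) = aP x (r n)].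
Proof.
pose t := partial_trace \1; pose s := partial_trace sP.
have t_conj n : sP (t n) = t (sN n).
  rewrite partial_trace_conj; congr (partial_trace _ _).
  by apply/lfunP => p; rewrite !comp_lfunE !id_lfunE sPK.
have s_conj n : sP (s n) = s (sN n).
  rewrite partial_trace_conj; congr (partial_trace _ _).
  by apply/lfunP => p; rewrite !comp_lfunE sPK.
(* This is [t] on even and [s] on odd vectors; an odd [x] carries the one into the other. Since t
   (iota q) = sP q and s (iota q) = q, each inverts [iota] on the vectors where it is used. *)
pose r := 2%:R^-1 *: ((t \o (\1 + sN)) + (s \o (\1 - sN)))%VF.
have rE n : r n = 2%:R^-1 *: (t (n + sN n) + s (n - sN n)).
  by rewrite scale_lfunE add_lfunE !comp_lfunE !add_lfunE opp_lfunE id_lfunE.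
have half (w : P) : 2%:R^-1 *: (w + w) = w.
  by rewrite -mulr2n -[w *+ 2]scaler_nat scalerA mulVf ?scale1r // pnatr_eq0.
exists r; split=> [q|n|[] x n xg]; rewrite !rE.
- have -> : t (iota q + sN (iota q)) = q + sP q.
    by rewrite -iota_conj -linearD partial_trace_iota id_lfunE linearD /= sPK addrC.
  have -> : s (iota q - sN (iota q)) = q - sP q.
    by rewrite -iota_conj -linearB partial_trace_iota sPK.
  by rewrite addrACA subrr addr0 half.
- rewrite (linearZ_LR sP) /= (linearD sP) /= t_conj s_conj.
  by rewrite (linearD sN) (linearB sN).
- pose p := n + sN n; pose m := n - sN n.
  have sp : sN p = p by rewrite linearD /= sNK addrC.
  have sm : sN m = - m by rewrite linearB /= sNK opprB.
  have -> : aN x n + sN (aN x n) = aN x m.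
    by rewrite (sN_act _ xg) expr1 scaleN1r linearB.
  have -> : aN x n - sN (aN x n) = aN x p.
    by rewrite (sN_act _ xg) expr1 scaleN1r opprK linearD.
  rewrite (linearZ_LR (aP x)) /= (linearD (aP x)) /= -/p -/m addrC.
  rewrite !(partial_trace_odd _ _ xg) sp sm; congr (_ *: (_ + _)).
    have -> : (sP \o \1 \o (sP \o aP x) = aP x \o \1)%VF.
      by apply/lfunP => v; rewrite !comp_lfunE !id_lfunE sPK.
    by rewrite subrr add0r comp_lfun1r.
  have -> : (sP \o sP \o (sP \o aP x) = - (aP x \o sP))%VF.
    apply/lfunP => v; rewrite opp_lfunE !comp_lfunE sPK (sP_act _ xg) expr1.
    by rewrite scaleN1r.
  rewrite partial_traceN (linearN (partial_trace (aP x \o sP))) /= opprK subrr add0r; congr (partial_trace _ _).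
  by apply/lfunP => v; rewrite comp_lfunE id_lfunE sPK.
- have sx v : sN (aN x v) = aN x (sN v) by rewrite (sN_act _ xg) scale1r.
  rewrite sx -(linearD (aN x)) -(linearB (aN x)).
  rewrite (linearZ_LR (aP x)) /= (linearD (aP x)) /= !(partial_trace_even _ _ xg).
  congr (_ *: (_ + _)).
    by rewrite comp_lfun1l comp_lfun1r subrr add0r.
  have -> : (aP x \o sP = sP \o aP x)%VF.
    by apply/lfunP => v; rewrite !comp_lfunE (sP_act _ xg) scale1r.
  by rewrite subrr add0r.
Qed.
End Retraction.

(** * Restriction of homomorphisms along an embedding *)

Section Precomposition.
Variables (K : numFieldType) (G P N X : vectType K) (gpart : bool -> {vspace G}).
Variables (aP : 'Hom(G, 'End(P))) (aN : 'Hom(G, 'End(N))) (aX : 'Hom(G, 'End(X))).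
Variables (sP : 'End(P)) (sN : 'End(N)) (sX : 'End(X)) (iota : 'Hom(P, N)).
Hypothesis iota_conj : forall v, iota (sP v) = sN (iota v).
Hypothesis iota_act : forall x v, iota (aP x v) = aN x (iota v).

Lemma precomp_linear : linear (fun F : 'Hom(N, X) => (F \o iota)%VF).
Proof. by move=> k F F'; rewrite comp_lfunDl comp_lfunZl. Qed.

Definition precomp : 'Hom('Hom(N, X), 'Hom(P, X)) := mk_lfun precomp_linear.

Lemma precompE F v : precomp F v = F (iota v).
Proof. by rewrite mk_lfunE comp_lfunE. Qed.

Lemma precomp_conj F : precomp (hom_conj sN sX F) = hom_conj sP sX (precomp F).
Proof.
by apply/lfunP => v; rewrite precompE !hom_conjE precompE iota_conj.
Qed.

Lemma precomp_act x F :
  precomp (hom_act gpart aN aX sN sX x F) =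
  hom_act gpart aP aX sP sX x (precomp F).
Proof.
apply/lfunP => v; rewrite precompE !hom_act_def !hom_act_funE.
by rewrite -precomp_conj !precompE !iota_act.
Qed.

Lemma precomp_onto : lker iota == 0%VS -> limg precomp = fullv.
Proof.
move=> k0; apply/eqP; rewrite eqEsubv subvf; apply/subvP => F _.
have -> : F = precomp (F \o iota^-1)%VF; last by rewrite memv_img ?memvf.
by apply/lfunP => v; rewrite precompE comp_lfunE lker0_lfunK.
Qed.
End Precomposition.

(** * The category F *)

(* The vector spaces underlying Lie superalgebras and supermodules, over the
   constant CC R: comparing R[i]-structures up to conversion is expensive. *)
Definition CCl (R : realType) : numClosedFieldType := R[i].
Definition CC (R : realType) : numFieldType := CCl R.

Section Carriers.
Variables (R : realType) (g : lieSuperalgebra R) (M : smod g).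

Definition gvec : vectType (CC R) := lsa_sort g.
Definition gpart : bool -> {vspace gvec} := lsa_part g.
Definition gad : 'Hom(gvec, 'End(gvec)) := lsa_ad g.
Definition vec : vectType (CC R) := smod_sort M.
Definition vpart : bool -> {vspace vec} := smod_part M.
Definition act : 'Hom(gvec, 'End(vec)) := smod_act M.

Lemma gpart_directv : directv (gpart false + gpart true).
Proof. exact: lsa_directv. Qed.

Lemma gpart_full : (gpart false + gpart true)%VS = fullv.
Proof. exact: lsa_full. Qed.

Lemma gad_parity i j x y : x \in gpart i -> y \in gpart j ->
  gad x y \in gpart (i (+) j).
Proof. exact: lsa_parity. Qed.

Lemma vpart_directv : directv (vpart false + vpart true).
Proof. exact: smod_directv. Qed.

Lemma vpart_full : (vpart false + vpart true)%VS = fullv.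
Proof. exact: smod_full. Qed.

Lemma act_parity i j x v : x \in gpart i -> v \in vpart j ->
  act x v \in vpart (i (+) j).
Proof. exact: smod_parity. Qed.

Lemma act_bracket i j x y v : x \in gpart i -> y \in gpart j ->
  act (gad x y) v = act x (act y v) - (-1) ^+ (i && j) *: act y (act x v).
Proof. exact: smod_bracket. Qed.
End Carriers.

Section Supermodules.
Variables (R : realType) (g : lieSuperalgebra R).
Implicit Types M N : smod g.

Definition sgn M : 'End(vec M) := locked (parity_op (vpart M)).

Lemma sgnK M v : sgn M (sgn M v) = v.
Proof. by rewrite /sgn -lock (parity_opK (vpart_directv M) (vpart_full M)). Qed.

Lemma mem_vpart M i v : (v \in vpart M i) = (sgn M v == (-1) ^+ i *: v).
Proof. by rewrite /sgn -lock (parity_opP (vpart_directv M) (vpart_full M)). Qed.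

Lemma smod_decomp M (v : vec M) : exists2 v0, v0 \in vpart M false &
  exists2 v1, v1 \in vpart M true & v = v0 + v1.
Proof. by apply/memv_addP; rewrite vpart_full memvf. Qed.

Lemma sgn_act M i x v : x \in gpart g i ->
  sgn M (act M x v) = (-1) ^+ i *: act M x (sgn M v).
Proof.
move=> xi.
have hom j w : w \in vpart M j ->
    sgn M (act M x w) = (-1) ^+ i *: act M x (sgn M w).
  move=> wj; have := act_parity xi wj.
  move: wj; rewrite !mem_vpart => /eqP-> /eqP->.
  by rewrite linearZ /= scalerA signr_addb.
have [v0 v0P [v1 v1P ->]] := smod_decomp v.
by rewrite !linearD /= (hom _ _ v0P) (hom _ _ v1P).
Qed.

Lemma even_homP M N (f : 'Hom(vec M, vec N)) : even_hom f <->
  (forall v, f (sgn M v) = sgn N (f v)) /\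
  (forall x v, f (act M x v) = act N x (f v)).
Proof.
split=> -[fp fa]; split=> //.
  move=> v; have hom j w : w \in vpart M j -> f (sgn M w) = sgn N (f w).
    move=> wj; have := subvP (fp j) _ (memv_img f wj).
    by move: wj; rewrite !mem_vpart => /eqP-> /eqP->; rewrite linearZ.
  have [v0 v0P [v1 v1P ->]] := smod_decomp v.
  by rewrite !linearD /= (hom _ _ v0P) (hom _ _ v1P).
move=> i; apply/subvP => _ /memv_imgP[v vi ->]; move: vi.
rewrite !mem_vpart => /eqP vi; by rewrite -fp vi linearZ.
Qed.

Lemma act_homogeneous M N (f : 'Hom(vec M, vec N)) :
  (forall i x v, x \in gpart g i -> f (act M x v) = act N x (f v)) ->
  forall x v, f (act M x v) = act N x (f v).
Proof.
move=> fh x v; have /memv_addP[x0 x0g [x1 x1g ->]] :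
    x \in (gpart g false + gpart g true)%VS by rewrite gpart_full memvf.
by rewrite !linearD !add_lfunE linearD /= (fh _ _ _ x0g) (fh _ _ _ x1g).
Qed.

Definition evact M (i : {x : gvec g | x \in gpart g false}) : 'End(vec M) :=
  act M (sval i).

Lemma gradedP M (U : {vspace vec M}) :
  U = (U :&: vpart M false + U :&: vpart M true)%VS <->
  (forall u, u \in U -> sgn M u \in U).
Proof.
split=> [UE u|Us].
  rewrite {1}UE => /memv_addP[u0 /memv_capP[u0U]]; rewrite mem_vpart => /eqP s0.
  case=> u1 /memv_capP[u1U]; rewrite mem_vpart => /eqP s1 ->.
  by rewrite linearD /= s0 s1 memvD ?memvZ.
apply/eqP; rewrite eqEsubv subv_add !capvSl !andbT; apply/subvP => u uU.
have [u0 u0P [u1 u1P uE]] := smod_decomp u.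
have sE : sgn M u = u0 - u1.
  move: (u0P) (u1P); rewrite uE linearD /= !mem_vpart => /eqP-> /eqP->.
  by rewrite scale1r scaleN1r.
have two_neq0 : 2%:R != 0 :> (CC R) by rewrite pnatr_eq0.
have half (w : vec M) : 2%:R^-1 *: (w + w) = w.
  by rewrite -mulr2n -[w *+ 2]scaler_nat scalerA mulVf // scale1r.
rewrite uE; apply: memv_add; apply/memv_capP; split=> //.
  have -> : u0 = 2%:R^-1 *: (u + sgn M u).
    by rewrite sE uE addrACA subrr addr0 half.
  by rewrite memvZ // memvD // Us.
have -> : u1 = 2%:R^-1 *: (u - sgn M u).
  by rewrite sE uE opprB [u1 - u0]addrC addrACA subrr add0r half.
by rewrite memvZ // memvB // Us.
Qed.

Lemma subsmodP M (h : {vspace gvec g}) (U : {vspace vec M}) : subsmod h U <->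
  (forall x u, x \in h -> u \in U -> act M x u \in U) /\
  (forall u, u \in U -> sgn M u \in U).
Proof.
rewrite -gradedP; split=> [[UE Ua]|[Ua UE]]; split=> //.
  by move=> x u xh uU; apply: subvP (Ua x xh) _ (memv_img _ uU).
by move=> x xh; apply/subvP => _ /memv_imgP[u uU ->]; apply: Ua.
Qed.

Lemma even_subsmodP M (U : {vspace vec M}) : subsmod (gpart g false) U <->
  stablev (evact M) U /\ (forall u, u \in U -> sgn M u \in U).
Proof.
rewrite subsmodP; split=> -[Ua Us]; split=> //.
  by move=> [x xg] u uU; apply: Ua.
by move=> x u xg uU; apply: (Ua (exist _ x xg)).
Qed.

(** A simple graded subspace lies in a single parity, because even elements preserve its
    intersection with each part. All its subspaces are then graded, so it stays simple when the
    grading is forgotten. *)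
Lemma inF_simple_generated M : inF M -> simple_generated (evact M).
Proof.
case=> n [U [Us _ Ufull]] X sX nX.
have [/forallP UX|/forallPn[i UiX]] := boolP [forall i, (U i <= X)%VS].
  by case: nX; apply/eqP; rewrite eqEsubv subvf -Ufull; apply/subv_sumP.
exists (U i) => //; have [/even_subsmodP[sU gU] U0 Umin] := Us i.
split=> // W sW WU.
have cap j : (U i :&: vpart M j)%VS = 0%VS \/ (U i :&: vpart M j)%VS = U i.
  apply: Umin; last exact: capvSl.
  apply/even_subsmodP; split=> [x u /memv_capP[uU uj]|u /memv_capP[uU uj]].
    apply/memv_capP; split; first exact: sU.
    by have := act_parity (valP x : _ \in gpart g false) uj; rewrite addFb.
  apply/memv_capP; split; first exact: gU.
  by move: uj; rewrite mem_vpart => /eqP uj; rewrite uj memvZ // mem_vpart uj.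
have [j Uj] : exists j, (U i <= vpart M j)%VS.
  have [E0|<-] := cap false; last by exists false; apply: capvSr.
  have [E1|<-] := cap true; last by exists true; apply: capvSr.
  have [[UE _] _ _] := Us i; by case: U0; rewrite UE E0 E1 addv0.
apply: Umin => //; apply/even_subsmodP; split=> // u uW.
have := subvP (subv_trans WU Uj) u uW; rewrite mem_vpart => /eqP->.
exact: memvZ.
Qed.

(** The sign operator is adjoined to the family, so that stable subspaces become graded. The mean of
    [e] and its conjugate by the sign operator commutes with that operator and is still a projection
    onto a graded [U]. *)
Lemma completely_reducible_inF M : completely_reducible (evact M) -> inF M.
Proof.
move=> cr.
pose a' i := if i is Some j then evact M j else sgn M.
have a'P U : stablev a' U <-> subsmod (gpart g false) U.
  rewrite even_subsmodP; split=> [sU|[sU gU]].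
    by split=> [i|]; [exact: (sU (Some i)) | exact: (sU None)].
  by case=> [i|]; [exact: sU | exact: gU].
have : completely_reducible a'.
  move=> U sa'U; have /even_subsmodP[sU gU] := proj1 (a'P U) sa'U; have [e [ec eU eid]] := cr U sU.
  pose e' : 'End(vec M) := 2%:R^-1 *: (e + (sgn M \o e \o sgn M)%VF).
  have e'E v : e' v = 2%:R^-1 *: (e v + sgn M (e (sgn M v))).
    by rewrite scale_lfunE add_lfunE !comp_lfunE.
  have sev i v : sgn M (evact M i v) = evact M i (sgn M v).
    by rewrite (sgn_act _ (valP i : _ \in gpart g false)) scale1r.
  exists e'; split=> [[i|] v|v|u uU]; rewrite !e'E /=.
  - by rewrite [RHS]linearZ /= [evact M i (_ + _)]linearD /= sev !ec sev.
  - by rewrite sgnK [RHS]linearZ /= [sgn M (_ + _)]linearD /= sgnK addrC.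
  - by rewrite memvZ // memvD ?gU.
  - rewrite !eid ?gU // sgnK -mulr2n -[u *+ 2]scaler_nat scalerA mulVf ?scale1r //.
    by rewrite pnatr_eq0.
case/simple_decomposition => n [U [Us Ud Uf]]; exists n, U; split=> // i.
have [/a'P sU U0 Umin] := Us i; split=> // W /a'P sW; exact: Umin.
Qed.


Lemma homS_parity M N i j x f : x \in gpart g i ->
  f \in eigenpart (hom_conj (sgn M) (sgn N)) j ->
  hom_act (gpart g) (act M) (act N) (sgn M) (sgn N) x f
    \in eigenpart (hom_conj (sgn M) (sgn N)) (i (+) j).
Proof.
apply: hom_act_parity; solve [exact: sgnK | exact: gpart_directv | exact: gpart_full | exact: sgn_act].
Qed.

Lemma homS_bracket M N i j x y f : x \in gpart g i -> y \in gpart g j ->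
  let act := hom_act (gpart g) (act M) (act N) (sgn M) (sgn N) in
  act (gad g x y) f = act x (act y f) - (-1) ^+ (i && j) *: act y (act x f).
Proof.
apply: hom_act_bracket; solve [exact: sgnK | exact: gpart_directv | exact: gpart_full |
  exact: sgn_act | exact: gad_parity | exact: act_bracket].
Qed.

Definition homS M N : smod g :=
  @Smod R g _ (eigenpart (hom_conj (sgn M) (sgn N)))
    (hom_act (gpart g) (act M) (act N) (sgn M) (sgn N))
    (eigenpart_direct _)
    (eigenpart_full (hom_conjK (sgnK (M := M)) (sgnK (M := N))))
    (@homS_parity M N) (@homS_bracket M N).

Lemma sgn_homS M N : sgn (homS M N) = hom_conj (sgn M) (sgn N).
Proof.
rewrite {1}/sgn -lock; apply: parity_op_eigenpart; apply: hom_conjK; exact: sgnK.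
Qed.

Lemma homS_inF M N : inF M -> inF N -> inF (homS M N).
Proof.
move=> /inF_simple_generated sM /inF_simple_generated sN.
apply: completely_reducible_inF.
(* Even elements produce no sign, so the action on Hom is the plain commutator. *)
have -> : evact (homS M N) = (fun i => hom_ad (evact N i) (evact M i)).
  apply/funext => i; apply/lfunP => f; apply/lfunP => v; rewrite hom_adE.
  exact: (hom_actE _ _ _ _ (gpart_directv g) (gpart_full g) _ _ (valP i)).
exact: completely_reducible_hom.
Qed.

Definition unit_part (i : bool) : {vspace (CC R)^o} := if i then 0%VS else fullv.

Lemma unit_directv : directv (unit_part false + unit_part true).
Proof. by apply/directv_addP; rewrite capv0. Qed.

Lemma unit_full : (unit_part false + unit_part true)%VS = fullv.
Proof. exact: addv0. Qed.

Lemma unit_parity i j x v : x \in gpart g i -> v \in unit_part j ->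
  (0 : 'Hom(gvec g, 'End((CC R)^o))) x v \in unit_part (i (+) j).
Proof. by move=> _ _; rewrite !zero_lfunE mem0v. Qed.

Lemma unit_bracket i j x y v : x \in gpart g i -> y \in gpart g j ->
  let act : 'Hom(gvec g, 'End((CC R)^o)) := 0 in
  act (gad g x y) v = act x (act y v) - (-1) ^+ (i && j) *: act y (act x v).
Proof. by move=> _ _ /=; rewrite !zero_lfunE scaler0 subr0. Qed.

Definition unitS : smod g :=
  @Smod R g _ unit_part 0 unit_directv unit_full unit_parity unit_bracket.

Lemma sgn_unitS : sgn unitS = \1%VF.
Proof.
apply/lfunP => v; rewrite id_lfunE; apply/eqP; rewrite -[X in _ == X]scale1r.
by rewrite -(mem_vpart (M := unitS) false) memvf.
Qed.

Lemma unitS_inF : inF unitS.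
Proof.
apply: completely_reducible_inF => U _; exists (projv U); split.
- by move=> i v; rewrite /evact /= !zero_lfunE linear0.
- exact: memv_proj.
- by move=> u; apply: projv_id.
Qed.

End Supermodules.

(** * Projectives are injective *)

Section Splitting.
Variables (R : realType) (g : lieSuperalgebra R).
Implicit Types M N P : smod g.

Definition dualS P : smod g := homS P (unitS g).
Definition tensS P : smod g := homS (dualS P) P.

(** These identity maps present the carriers of the dual and of the tensor square as the abstract
    spaces [D] and [X] of the partial trace construction. *)
Definition dual_val P : 'Hom(vec (dualS P), 'Hom(vec P, (CC R)^o)) :=
  (\1%VF : 'End(vec (dualS P))).
Definition dual_of P : 'Hom('Hom(vec P, (CC R)^o), vec (dualS P)) :=
  (\1%VF : 'End(vec (dualS P))).
Definition tens_val P : 'Hom(vec (tensS P), 'Hom(vec (dualS P), vec P)) :=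
  (\1%VF : 'End(vec (tensS P))).
Definition tens_of P : 'Hom('Hom(vec (dualS P), vec P), vec (tensS P)) :=
  (\1%VF : 'End(vec (tensS P))).

Lemma dual_ofK P f : dual_val P (dual_of P f) = f.
Proof. by rewrite !id_lfunE. Qed.

Lemma dual_valK P f : dual_of P (dual_val P f) = f.
Proof. by rewrite !id_lfunE. Qed.

Lemma tens_ofK P f : tens_val P (tens_of P f) = f.
Proof. by rewrite !id_lfunE. Qed.

Lemma tens_valK P f : tens_of P (tens_val P f) = f.
Proof. by rewrite !id_lfunE. Qed.

Lemma hom_smod_actE M N i x (f : 'Hom(vec M, vec N)) v : x \in gpart g i ->
  (act (homS M N) x f : 'Hom(vec M, vec N)) v =
  act N x (f v) - conj_if (sgn M) (sgn N) i f (act M x v).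
Proof. exact: (hom_actE _ _ _ _ (gpart_directv g) (gpart_full g)). Qed.

Lemma hom_smod_sgnE M N (f : 'Hom(vec M, vec N)) v :
  (sgn (homS M N) f : 'Hom(vec M, vec N)) v = sgn N (f (sgn M v)).
Proof. by rewrite sgn_homS; exact: hom_conjE. Qed.

Lemma dual_val_sgn P xi v :
  dual_val P (sgn (dualS P) xi) v = dual_val P xi (sgn P v).
Proof.
rewrite !id_lfunE; have := hom_smod_sgnE (xi : 'Hom(vec P, vec (unitS g))) v.
by rewrite sgn_unitS id_lfunE.
Qed.

Lemma dual_val_act P i x xi v : x \in gpart g i ->
  dual_val P (act (dualS P) x xi) v =
  - dual_val P xi ((if i then sgn P else \1%VF) (act P x v)).
Proof.
move=> xg; rewrite !id_lfunE.
have := hom_smod_actE (xi : 'Hom(vec P, vec (unitS g))) v xg.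
rewrite [act (unitS g) x _](_ : _ = 0); last by rewrite !zero_lfunE.
rewrite sub0r => ->; congr (- _); case: (i); rewrite /= ?id_lfunE //.
by rewrite hom_conjE sgn_unitS id_lfunE.
Qed.

Lemma tens_val_sgn P th xi :
  tens_val P (sgn (tensS P) th) xi = sgn P (tens_val P th (sgn (dualS P) xi)).
Proof. by rewrite !id_lfunE; exact: hom_smod_sgnE. Qed.

Lemma tens_val_act_even P x th xi : x \in gpart g false ->
  tens_val P (act (tensS P) x th) xi =
  act P x (tens_val P th xi) - tens_val P th (act (dualS P) x xi).
Proof. by move=> xg; rewrite !id_lfunE; exact: hom_smod_actE xg. Qed.

Lemma tens_val_act_odd P x th xi : x \in gpart g true ->
  tens_val P (act (tensS P) x th) xi = act P x (tens_val P th xi)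
    - sgn P (tens_val P th (sgn (dualS P) (act (dualS P) x xi))).
Proof.
move=> xg; rewrite !id_lfunE; apply: etrans (hom_smod_actE _ _ xg) _.
by rewrite /conj_if hom_conjE.
Qed.

Lemma projectiveF_split P N (iota : 'Hom(vec P, vec N)) :
  projectiveF P -> inF N -> even_hom iota -> lker iota == 0%VS ->
  exists2 r : 'Hom(vec N, vec P), even_hom r & forall q, r (iota q) = q.
Proof.
move=> [FP projP] FN /even_homP[iota_s iota_a] iota0.
pose X := tensS P.
have FX : inF X by apply: homS_inF => //; apply: homS_inF => //; exact: unitS_inF.
pose res : 'Hom(vec (homS N X), vec (homS P X)) := precomp (vec X) iota.
pose phi : 'Hom(vec P, vec (homS P X)) :=
  contraction (sgn P) (dual_val P) (tens_of P).
have res_even : even_hom res.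
  apply/even_homP; split=> [F|x F]; first by rewrite !sgn_homS; apply: precomp_conj.
  exact: precomp_act.
have phi_even : even_hom phi.
  apply/even_homP; split=> [p|].
    rewrite sgn_homS; exact: (contraction_conj (@sgnK _ _ P) (@tens_ofK P) (@tens_valK P)
      (@dual_val_sgn P) (@tens_val_sgn P)).
  apply: act_homogeneous => i x p xi.
  exact: (contraction_act (gpart_directv g) (gpart_full g) (@sgnK _ _ P) (@sgn_act _ _ P)
    (@tens_ofK P) (@tens_valK P) (@dual_val_sgn P) (@dual_val_act P)
    (@tens_val_sgn P) (@tens_val_act_even P) (@tens_val_act_odd P) p xi).
have [Phi /even_homP[Phi_s Phi_a] PhiE] :=
  projP _ _ res phi (homS_inF FN FX) (homS_inF FP FX) res_even
    (precomp_onto (vec X) iota0) phi_even.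
pose Psi : 'Hom(vec P, 'Hom(vec N, vec X)) := Phi.
have Psi_s p : Psi (sgn P p) = hom_conj (sgn N) (sgn X) (Psi p).
  by rewrite -sgn_homS; exact: Phi_s.
have Psi_iota p q xi :
    tens_val P (Psi p (iota q)) xi = (dual_val P xi (sgn P q) : CC R) *: p.
  rewrite -(contractionE _ _ (@tens_ofK P)) -[contraction _ _ _]/phi -PhiE.
  by rewrite comp_lfunE [res _]mk_lfunE comp_lfunE.
have [r [rK rs ra]] := exists_super_retraction (gpart_directv g) (gpart_full g)
  (@sgnK _ _ P) (@sgnK _ _ N) (@sgn_act _ _ P) (@sgn_act _ _ N)
  (@dual_ofK P) (@dual_valK P) (@dual_val_sgn P) (@dual_val_act P)
  (@tens_val_sgn P) (@tens_val_act_even P) (@tens_val_act_odd P)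
  (Phi_a : forall x p, Psi (act P x p) =
    hom_act (gpart g) (act N) (act X) (sgn N) (sgn X) x (Psi p))
  Psi_s iota_s Psi_iota.
exists r => //; apply/even_homP; split=> //.
exact: act_homogeneous.
Qed.
End Splitting.

(** * Resolutions and complexity *)

Section Resolutions.
Variables (R : realType) (g : lieSuperalgebra R).
Implicit Types M N P : smod g.

Definition null M := \dim {:vec M} = 0%N.

Lemma null_vec M (v : vec M) : null M -> v = 0.
Proof.
move=> /eqP; rewrite dimv_eq0 => /eqP M0; apply/eqP.
by rewrite -memv0 -M0 memvf.
Qed.

Lemma null_subvP M (U W : {vspace vec M}) : null M -> (U <= W)%VS.
Proof. by move=> M0; apply/subvP => u _; rewrite (null_vec u M0) mem0v. Qed.

Lemma subsmod_limg M N (f : 'Hom(vec M, vec N)) :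
  even_hom f -> subsmod (fullv : {vspace gvec g}) (limg f).
Proof.
move=> /even_homP[fs fa]; apply/subsmodP; split=> [x _ _ /memv_imgP[v _ ->]|].
  by rewrite -fa memv_img ?memvf.
by move=> _ /memv_imgP[v _ ->]; rewrite -fs memv_img ?memvf.
Qed.

Lemma subsmod_lker M N (f : 'Hom(vec M, vec N)) :
  even_hom f -> subsmod (fullv : {vspace gvec g}) (lker f).
Proof.
move=> /even_homP[fs fa]; apply/subsmodP; split=> [x v _|v].
  by rewrite !memv_ker fa => /eqP->; rewrite linear0.
by rewrite !memv_ker fs => /eqP->; rewrite linear0.
Qed.

Lemma superfluous_null M (K : {vspace vec M}) :
  superfluous K -> K = fullv -> null M.
Proof.
move=> supK KE; rewrite /null; have -> : {:vec M}%VS = 0%VS; last exact: dimv0.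
symmetry; apply: supK; last by rewrite KE add0v.
by apply/subsmodP; split=> [x u _|u]; rewrite !memv0 => /eqP->; rewrite linear0.
Qed.

(** A retraction [r] writes [N] as [lker r] plus [limg f]. Superfluity makes [lker r] everything, so
    [r], which is onto [P], is 0. *)
Lemma projectiveF_superfluous_null P N (f : 'Hom(vec P, vec N)) :
  projectiveF P -> inF N -> even_hom f -> lker f == 0%VS ->
  superfluous (limg f) -> null P.
Proof.
move=> projP FN fe f0 sup; have [r re rK] := projectiveF_split projP FN fe f0.
have rker : lker r = fullv.
  apply: sup; first exact: subsmod_lker.
  apply/eqP; rewrite eqEsubv subvf; apply/subvP => v _.
  rewrite -[v](subrK (f (r v))); apply: memv_add; last by rewrite memv_img ?memvf.
  by rewrite memv_ker linearB /= rK subrr.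
rewrite /null; have -> : {:vec P}%VS = 0%VS; last exact: dimv0.
apply/eqP; rewrite -subv0; apply/subvP => p _; rewrite memv0 -(rK p).
by rewrite -memv_ker rker memvf.
Qed.

Lemma projectiveF_iso P M (f : 'Hom(vec P, vec M)) : projectiveF P -> inF M ->
  even_hom f -> limg f = fullv -> lker f == 0%VS -> projectiveF M.
Proof.
move=> [_ projP] FM fe ff f0; split=> // A B p h FA FB pe pf he.
have /even_homP[fs fa] := fe; have /even_homP[hs ha] := he.
have hfe : even_hom (h \o f : 'Hom(vec P, vec B))%VF.
  apply/even_homP; split=> [v|x v]; rewrite !comp_lfunE; first by rewrite fs hs.
  by rewrite fa ha.
have [k /even_homP[ks ka] kE] := projP A B p (h \o f)%VF FA FB pe pf hfe.
have fVK v : f (f^-1%VF v) = v by apply: limg_lfunVK; rewrite ff memvf.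
have fKV v : f^-1%VF (f v) = v by apply: lker0_lfunK.
exists (k \o f^-1)%VF.
  apply/even_homP; split=> [v|x v]; rewrite !comp_lfunE -{1}(fVK v).
    by rewrite -fs fKV ks.
  by rewrite -fa fKV ka.
apply/lfunP => v; rewrite !comp_lfunE -comp_lfunE kE comp_lfunE.
by rewrite fVK.
Qed.

Lemma finite_resolution_projectiveF M (Q : nat -> smod g) T : inF M ->
  minimal_resolution M Q -> (forall t, (T <= t)%N -> null (Q t)) ->
  projectiveF M.
Proof.
move=> FM [d [eps [projQ [epse de] [epsf d0 dS] [supe supd]]]] QT.
have Q0 k t : (T <= t + k)%N -> null (Q t.+1).
  elim: k t => [|k IHk] t.
    by rewrite addn0 => Tt; apply: QT; apply: leq_trans Tt (leqnSn t).
  rewrite addnS -addSn => /IHk Qt2.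
  apply: (projectiveF_superfluous_null (f := d t) (projQ t.+1)
    (proj1 (projQ t)) (de t)).
    rewrite -dS -subv0; apply/subvP => _ /memv_imgP[v _ ->].
    by rewrite (null_vec v Qt2) linear0 mem0v.
  by case: (t) => [|t']; [rewrite d0 | rewrite dS].
apply: (projectiveF_iso (f := eps) (projQ 0%N) FM epse epsf).
rewrite -d0 -subv0; apply/subvP => _ /memv_imgP[v _ ->].
have Q1 : null (Q 1%N) by apply: (Q0 T); rewrite leq_addl.
by rewrite (null_vec v Q1) linear0 mem0v.
Qed.

Lemma projectiveF_resolution_null M (Q : nat -> smod g) t : projectiveF M ->
  minimal_resolution M Q -> null (Q t.+1).
Proof.
move=> [FM projM] [d [eps [projQ [epse de] [epsf d0 dS] [supe supd]]]].
have ide : even_hom (\1%VF : 'End(vec M)).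
  by apply/even_homP; split=> [v|x v]; rewrite !id_lfunE.
have [k ke kE] := projM (Q 0%N) M eps \1%VF (proj1 (projQ 0%N)) FM epse epsf ide.
have epsk v : eps (k v) = v by rewrite -comp_lfunE kE id_lfunE.
have kf : limg k = fullv.
  apply: supe; first exact: subsmod_limg.
  apply/eqP; rewrite eqEsubv subvf; apply/subvP => q _.
  rewrite -[q](subrKC (k (eps q))); apply: memv_add; first by rewrite memv_img ?memvf.
  by rewrite memv_ker linearB /= epsk subrr.
have eps0 : lker eps = 0%VS.
  apply/eqP; rewrite -subv0; apply/subvP => q; rewrite memv_ker memv0.
  have /memv_imgP[m _ ->] : q \in limg k by rewrite kf memvf.
  by rewrite epsk => /eqP->; rewrite linear0.
have dnull s : limg (d s) = 0%VS -> null (Q s.+1).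
  move=> ds0; apply: (superfluous_null (supd s)); apply/eqP.
  by rewrite eqEsubv subvf lkerE ds0 eqxx.
elim: t => [|t IHt]; first by apply: dnull; rewrite d0.
apply: dnull; rewrite dS; apply/eqP; rewrite -subv0.
exact: (null_subvP _ _ IHt).
Qed.

Lemma null_vspace_eq M (U W : {vspace vec M}) : null M -> U = W.
Proof. by move=> M0; apply/eqP; rewrite eqEsubv !null_subvP. Qed.

Definition zero_part (i : bool) : {vspace 'rV[CC R]_0} := 0%VS.

Lemma zero_directv : directv (zero_part false + zero_part true).
Proof. by apply/directv_addP; rewrite capv0. Qed.

Lemma zero_full : (zero_part false + zero_part true)%VS = fullv.
Proof. by rewrite addv0; apply/vspaceP => v; rewrite [v]thinmx0 !mem0v. Qed.

Lemma zero_parity i j x v : x \in gpart g i -> v \in zero_part j ->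
  (0 : 'Hom(gvec g, 'End('rV[CC R]_0))) x v \in zero_part (i (+) j).
Proof. by move=> _ _; rewrite !zero_lfunE mem0v. Qed.

Lemma zero_bracket i j x y v : x \in gpart g i -> y \in gpart g j ->
  let act : 'Hom(gvec g, 'End('rV[CC R]_0)) := 0 in
  act (gad g x y) v = act x (act y v) - (-1) ^+ (i && j) *: act y (act x v).
Proof. by move=> _ _ /=; rewrite !zero_lfunE scaler0 subr0. Qed.

Definition zeroS : smod g :=
  @Smod R g _ zero_part 0 zero_directv zero_full zero_parity zero_bracket.

Lemma zeroS_null : null zeroS.
Proof. by rewrite /null dimvf. Qed.

Lemma zeroS_projective : projectiveF zeroS.
Proof.
split=> [|M N f h FM FN fe ff he].
  exists 0%N, (fun=> 0%VS); split=> [[]//||].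
    by rewrite directvE /= !big_ord0 dimv0.
  by rewrite big_ord0; apply/vspaceP => v; rewrite (null_vec v zeroS_null) !mem0v.
exists 0.
  apply/even_homP; split=> [v|x v]; rewrite !zero_lfunE linear0 //.
by apply/lfunP => v; rewrite (null_vec v zeroS_null) !linear0.
Qed.

Lemma projectiveF_minimal_resolution M : projectiveF M ->
  minimal_resolution M (fun t => if t is 0 then M else zeroS).
Proof.
move=> projM; pose Q t := if t is 0 then M else zeroS.
have even0 A B : even_hom (0 : 'Hom(vec A, vec B)).
  by apply/even_homP; split=> [v|x v]; rewrite !zero_lfunE linear0.
exists (fun t => 0 : 'Hom(vec (Q t.+1), vec (Q t))), (\1%VF : 'End(vec M)).
have full0 : lker (\1%VF : 'End(vec M)) = 0%VS.
  by apply/vspaceP => v; rewrite memv_ker id_lfunE memv0.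
split.
- by case=> [|t] //; exact: zeroS_projective.
- split=> [|t]; last exact: even0.
  by apply/even_homP; split=> [v|x v]; rewrite !id_lfunE.
- split=> [||t]; [exact: lim1g | by rewrite lim0g full0 |].
  exact: (null_vspace_eq _ _ zeroS_null).
- split=> [U sU UE|t U sU UE]; first by rewrite -UE full0 addv0.
  exact: (null_vspace_eq _ _ zeroS_null).
Qed.

End Resolutions.

(** * Growth rate zero *)

Section Growth.
Variables (R : realType) (V : nat -> vectType R[i]).

Lemma growth_rate_eq0 : growth_rate V = Some 0%N <-> growth_bound V 0.
Proof.
rewrite /growth_rate; case: pselect => [h|nh]; last first.
  by split=> // V0; case: nh; exists 0%N.
case: ex_minnP => m /asboolP Vm mmin; split=> [[m0]|V0]; first by rewrite -m0.
by congr Some; apply/eqP; rewrite -leqn0; apply/mmin/asboolP.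
Qed.

(** For c = 0 the bound reads dim (V t) <= C / t, and a natural number below 1 is 0. *)
Lemma growth_bound0 : growth_bound V 0 <->
  exists T, forall t, (T <= t)%N -> (0 < t)%N -> \dim {:V t} = 0%N.
Proof.
split=> [[c c0 Vc]|[T VT]].
  exists (Num.bound c) => t ct t0; apply/eqP; rewrite -leqn0 -ltnS -(ltr_nat R).
  apply: le_lt_trans (Vc t t0) _; rewrite sub0r -invr_expz expr1z.
  rewrite ltr_pdivrMr ?ltr0n // mul1r.
  apply: lt_le_trans (archi_boundP (ltW c0)) _; by rewrite ler_nat.
(* The sum dominates each of the finitely many relevant products; adding 1 keeps the constant
   positive when they all vanish. *)
exists ((\sum_(t < T) \dim {:V t} * t)%N%:R + 1).
  by rewrite ltr_wpDl ?ler0n.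
move=> t t0; rewrite sub0r -invr_expz expr1z ler_pdivlMr ?ltr0n //.
have [Tt|tT] := leqP T t.
  by rewrite (VT t Tt t0) mul0r addr_ge0 ?ler0n ?ler01.
rewrite -natrM natr1 ler_nat.
apply: leq_trans (leqnSn _); rewrite (bigD1 (Ordinal tT)) //=; exact: leq_addr.
Qed.
End Growth.

Local Close Scope ring_scope.

Theorem corollary2p7p1 (R : realType) (g : lieSuperalgebra R)
    (hg : classical g) (M : smod g) (hM : inF M) :
  complexity M = Some 0 <-> projectiveF M.
Proof.
(* Without a minimal resolution the complexity is [None], and then [M] cannot be projective, because
   a projective [M] has the resolution concentrated in degree 0. *)
rewrite /complexity; case: pselect => [h|nres]; last first.
  split=> // projM; case: nres; exists (fun t => if t is 0 then M else zeroS g).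
  exact: projectiveF_minimal_resolution.
case: (cid h) => Q resQ /=; rewrite growth_rate_eq0 growth_bound0.
split=> [[T QT]|projM].
  (* The growth bound says nothing about degree 0, hence [T.+1] in place of [T]. *)
  apply: (finite_resolution_projectiveF (T := T.+1) hM resQ) => t Tt.
  by apply: QT; [exact: ltnW | exact: leq_trans Tt].
exists 0%N => -[|t] // _ _; exact: projectiveF_resolution_null resQ.
Qed.
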